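(* Let $\Omega\subset\mathbb{D}^{\mathbb{N}}$ be a set of sequences with the following two properties: (1) every sequence in $\Omega$ is a zero sequence for the Dirichlet space $\mathcal{D}$, and (2) whenever $\{z_n\}\in\Omega$ and $\{w_n\}\in\mathbb{D}^{\mathbb{N}}$ satisfies $|1-w_n|\le|1-z_n|$ for all $n\in\mathbb{N}$, then $\{w_n\}\in\Omega$. Then for all $\{z_n\}\in\Omega$, the set $$\overline{\left\{\frac{z_n}{|z_n|}:n\in\mathbb{N},\ z_n\ne0\right\}}$$ is a Carleson set.
   Context: $\mathbb{D}$ is the open unit disc in $\mathbb{C}$ and $\mathbb{T}$ the unit circle. The Dirichlet space $\mathcal{D}$ is the space of analytic functions $f$ on $\mathbb{D}$ with $\int_{\mathbb{D}}|f'|^2\,dA<\infty$ ($A$ normalized area measure). A sequence $Z$ in $\mathbb{D}$ (each point repeated finitely many times, repetitions encoding multiplicities) is a zero sequence for $\mathcal{D}$ if there is $f\in\mathcal{D}$ which has a zero of multiplicity exactly $m$ at each $z$ repeated $m$ times in $Z$ and satisfies $f(z)\ne0$ for all $z\in\mathbb{D}\setminus Z$. A compact set $E\subset\mathbb{T}$ is a Carleson set if $\int_{\mathbb{T}}\log\left(\frac{1}{\operatorname{dist}(z,E)}\right)|dz|<\infty$. *)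

(* Defs.v *)
From HB Require Import structures.
From mathcomp Require Import all_boot all_order all_algebra.
From mathcomp Require Import complex.
From mathcomp Require Import all_classical all_reals all_analysis.

Set Implicit Arguments.
Unset Strict Implicit.
Unset Printing Implicit Defensive.

Import Order.TTheory GRing.Theory Num.Theory.
Import numFieldNormedType.Exports.

Local Open Scope classical_set_scope.
Local Open Scope ring_scope.
Local Open Scope complex_scope.
Local Open Scope card_scope.

(* [(R[i])^o] is [R[i]] carrying the usual metric topology of the plane;
   [R[i]] itself only has the algebraic and norm structures. The norm and the
   order of [R[i]] are [R[i]]-valued: [`|z|] is a real element of [R[i]], and
   [x <= y] compares complex numbers with equal imaginary parts, so it is the
   usual order when both sides are norms. *)

Definition unit_disc (R : realType) : set R[i] := [set z | `|z| < 1].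

Definition unit_circle (R : realType) : set R[i] := [set z | `|z| = 1].

Definition analytic_at (R : realType) (f : R[i] -> R[i]) (a : R[i]) : Prop :=
  exists c : nat -> R[i], \forall w \near (a : (R[i])^o),
    (fun n : nat => \sum_(0 <= k < n) c k * (w - a) ^+ k : (R[i])^o) @ \oo
      --> (f w : (R[i])^o).

Definition complex_derive (R : realType) (f : R[i] -> R[i]) (z : R[i]) : R[i] :=
  'D_(1 : (R[i])^o) (f : (R[i])^o -> (R[i])^o) z.

(* Elements are total functions, but only their values on the disc matter: the
   disc is open, so [complex_derive f z] is local for [z] in it. *)
Definition dirichlet_space (R : realType) : set (R[i] -> R[i]) :=
  [set f | (forall z, unit_disc z -> analytic_at f z) /\
    (pi^-1%:E * \int[(@lebesgue_measure R \x @lebesgue_measure R)%E]_(p in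
        [set p : R * R | unit_disc (p.1 +i* p.2)])
      ((Normc.normc (complex_derive f (p.1 +i* p.2))) ^+ 2)%:E < +oo)%E].

Definition has_zero_of_order (R : realType) (f : R[i] -> R[i]) (z : R[i])
    (m : nat) : Prop :=
  exists g : R[i] -> R[i], [/\ analytic_at g z, g z != 0 &
    \forall w \near (z : (R[i])^o), f w = (w - z) ^+ m * g w].

Definition zero_sequence (R : realType) (Z : nat -> R[i]) : Prop :=
  [/\ forall n, unit_disc (Z n),
      forall z, finite_set [set n | Z n = z] &
      exists2 f, @dirichlet_space R f &
        (forall z m, range Z z -> [set n | Z n = z] #= `I_m ->
           has_zero_of_order f z m) /\
        (forall z, unit_disc z -> ~ range Z z -> f z != 0)].

Definition dist_to_set (R : realType) (z : R[i]) (E : set R[i]) : \bar R :=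
  ereal_inf [set (Normc.normc (z - w))%:E | w in E].

(* The arc length [|dz|] is [dt] under [z = cos t + i sin t]. As [lne] and
   [^-1] are those of the extended reals, the integrand is [+oo] on [E]. *)
Definition carleson_set (R : realType) (E : set R[i]) : Prop :=
  [/\ compact (E : set (R[i])^o), E `<=` @unit_circle R &
    (\int[@lebesgue_measure R]_(t in `[0%R, (2 * pi)%R])
       lne ((dist_to_set (cos t +i* sin t)%C E)^-1) < +oo)%E].

(* Main.v *)
(* Put d_n = |1 - z_n|. By the second property of Omega, each z_n may be replaced
   by a real point w_n = 1 - 2^-(k_n + 1) with |1 - w_n| <= d_n <= 2 * 2^-k_n; a
   function f in the Dirichlet space vanishing exactly on (w_n) has f(0) <> 0 and
   a zero at 1 - 2^-(k + 1) whose order is the number N_k of indices with k_n = k.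
   Since f grows at most like (1 - |z|)^-2, the maximum principle applied to f
   divided by a power of a Blaschke factor gives N_k = O(8^k).

   As |z_n / |z_n| - 1| <= 2 d_n, this suffices. Write y = |e^it - 1| and
   x_n = |e^it - z_n / |z_n||. If x_n < y / 2, then y = O(2^-k_n), so log (1 / x_n)
   is at most 4 log (1 / y) + O(1) plus the part of log (1 / x_n) exceeding 4 k_n;
   that part has integral O(16^-k_n) over the circle, and the sum over n of
   16^-k_n is finite because N_k = O(8^k). *)

Require Import Defs.
From mathcomp Require Import all_boot all_order all_algebra.
From mathcomp Require Import complex.
From mathcomp Require Import all_classical all_reals all_analysis.
From mathcomp Require Import measurable_realfun ring lra.

Import Order.TTheory GRing.Theory Num.Theory.
Import numFieldNormedType.Exports.

Local Open Scope classical_set_scope.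
Local Open Scope ring_scope.

Set Implicit Arguments.
Unset Strict Implicit.
Unset Printing Implicit Defensive.

Import Normc.

(** * Maximum principle *)

(** The estimates can be crude because the threshold [4 k_n] is free: a count of zeros that is
    exponential in [k] with any base below 16 would do. Hence a growth bound far from the sharp one
    suffices, and no formula summing over all zeros is needed: rounding to dyadic points makes the
    points of one scale coincide, so their number becomes the order of a single zero. In 8 = 4 * 2,
    the 4 is the growth at distance of order 2^-k from the circle, and the 2 appears because the
    Blaschke gain per zero is only 1 + O(2^-k). The obstacle for the growth bound is that the
    Dirichlet integral is an area integral, while values at points are wanted. Tonelli selects lines
    of small energy, the fundamental theorem of calculus controls [f] along them, and the maximum
    principle carries the bound inside. This uses only the maximum principle and a locally Lipschitz
    derivative, both of which follow from local power series without contour integrals. *)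

Section ComplexPlane.
Context {R : realType}.
Local Notation C := R[i].
Implicit Types (z w : C) (r : R).

Lemma normcE z : `|z| = (normc z)%:C%C.
Proof. by []. Qed.

Lemma normc_ge0 z : 0 <= normc z.
Proof. by case: z => a b /=; exact: sqrtr_ge0. Qed.

Lemma normcD z w : normc (z + w) <= normc z + normc w.
Proof. exact: (@le_normcD R). Qed.

Lemma normcN z : normc (- z) = normc z.
Proof. by case: z => a b /=; rewrite !sqrrN. Qed.

Lemma normcB z w : normc (z - w) <= normc z + normc w.
Proof. by rewrite -(normcN w); exact: normcD. Qed.

Lemma distcC z w : normc (z - w) = normc (w - z).
Proof. by rewrite -normcN opprB. Qed.

Lemma distcD w z v : normc (z - v) <= normc (z - w) + normc (w - v).
Proof. by apply: le_trans (normcD _ _); rewrite addrA subrK. Qed.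

Lemma dist_normc z w : `|normc z - normc w| <= normc (z - w).
Proof.
have := distcD w z 0; have := distcD z w 0; rewrite !subr0 (distcC w).
by move=> *; rewrite ler_norml; apply/andP; split; lra.
Qed.

Lemma normcX z n : normc (z ^+ n) = normc z ^+ n.
Proof.
elim: n => [|n IH]; first by rewrite !expr0 normc1.
by rewrite !exprS normcM IH.
Qed.

Lemma normc_eq0 z : (normc z == 0) = (z == 0).
Proof.
apply/eqP/eqP => [/eq0_normc //|->]; exact: normc0.
Qed.

Lemma normc_gt0 z : (0 < normc z) = (z != 0).
Proof. by rewrite lt_neqAle normc_ge0 andbT eq_sym normc_eq0. Qed.

Lemma normc_sum (I : Type) (s : seq I) (P : pred I) (F : I -> C) :
  normc (\sum_(i <- s | P i) F i) <= \sum_(i <- s | P i) normc (F i).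
Proof.
elim/big_rec2: _ => [|i x y _ xy]; first by rewrite normc0.
by apply: le_trans (normcD _ _) _; rewrite lerD2l.
Qed.

Lemma normc_real r : normc r%:C%C = `|r|.
Proof. by rewrite /= expr0n addr0 sqrtr_sqr. Qed.

Lemma normcC (x y : R) : normc (x +i* y)%C ^+ 2 = x ^+ 2 + y ^+ 2.
Proof. by rewrite /= sqr_sqrtr// addr_ge0// sqr_ge0. Qed.

Lemma normRe z : `|complex.Re z| <= normc z.
Proof.
by case: z => a b /=; rewrite -sqrtr_sqr ler_wsqrtr// lerDl sqr_ge0.
Qed.

Lemma normIm z : `|complex.Im z| <= normc z.
Proof.
by case: z => a b /=; rewrite -sqrtr_sqr ler_wsqrtr// lerDr sqr_ge0.
Qed.

Lemma normc_le_ReIm z : normc z <= `|complex.Re z| + `|complex.Im z|.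
Proof.
case: z => a b /=; rewrite -[leRHS]ger0_norm ?addr_ge0// -sqrtr_sqr ler_wsqrtr//.
rewrite sqrrD !real_normK ?num_real//.
by rewrite lerD2r lerDl mulrn_wge0// mulr_ge0.
Qed.

Lemma unit_discE z : unit_disc z <-> normc z < 1.
Proof. by rewrite /unit_disc /= normcE -[1]/(1%:C%C) ltcR. Qed.

Lemma nbhs_normcP (a : C^o) (P : set C) :
  nbhs a P <-> exists2 d, 0 < d & forall w, normc (w - a) < d -> P w.
Proof.
split=> [/nbhs_ballP[/= e e0 H]|[d d0 H]].
  move: (e0); rewrite ltcE/= => /andP[/eqP ie re].
  exists (complex.Re e) => // w wa; apply: H.
  by rewrite /ball/= -/(`|a - w|) normcE distcC ltcE /= wa ie eqxx.
apply/nbhs_ballP; exists d%:C%C; first by rewrite /= ltcR.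
by move=> w; rewrite /ball /= -/(`|a - w|) normcE ltcR distcC; apply: H.
Qed.

Lemma cvg_normcP (u : nat -> C) (l : C) :
  ((u : nat -> C^o) @ \oo --> (l : C^o)) <->
  forall e, 0 < e -> exists N, forall n, (N <= n)%N -> normc (u n - l) < e.
Proof.
split=> [ul e e0|H].
  have : nbhs (l : C^o) [set w | normc (w - l) < e].
    by apply/nbhs_normcP; exists e.
  by move/ul => -[N _ HN]; exists N => n Nn; exact: HN.
move=> P /= /nbhs_normcP[d d0 HP].
have [N HN] := H _ d0.
by exists N => // n Nn; exact/HP/HN.
Qed.

End ComplexPlane.

Section Jets.
Context {R : realType}.
Local Notation C := R[i].
Implicit Types (f F G : C -> C) (a z w h : C).

(* Third-order Peano expansions suffice for the maximum principle and, unlike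
   power series, are trivially stable under products and quotients. *)
Definition has_jet F a := exists P : {poly C}, exists B : R, exists d : R,
  [/\ 0 <= B, 0 < d &
      forall h, normc h < d -> normc (F (a + h) - P.[h]) <= B * normc h ^+ 4].

Lemma poly_bounded (P : {poly C}) : exists2 B : R, 0 <= B &
  forall h, normc h <= 1 -> normc P.[h] <= B.
Proof.
exists (\sum_(i < size P) normc P`_i); first by apply: sumr_ge0 => i _; exact: normc_ge0.
move=> h h1; rewrite horner_coef (le_trans (normc_sum _ _ _))//.
apply: ler_sum => i _; rewrite normcM normcX ler_piMr ?normc_ge0//.
by rewrite exprn_ile1 ?normc_ge0.
Qed.

Lemma jet_value F a (P : {poly C}) (B d : R) : 0 < d ->
  (forall h, normc h < d -> normc (F (a + h) - P.[h]) <= B * normc h ^+ 4) ->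
  F a = P.[0].
Proof.
move=> d0 H; have := H 0; rewrite normc0 addr0 expr0n mulr0 => /(_ d0) H0.
by apply/eqP; rewrite -subr_eq0 -normc_eq0 eq_le normc_ge0 H0.
Qed.

Lemma poly_split0 (P : {poly C}) : exists Q, P = Q * 'X + P.[0]%:P.
Proof.
have /factor_theorem[Q QE] : root (P - P.[0]%:P) 0 by rewrite rootE !hornerE subrr.
by exists Q; rewrite subr0 in QE; rewrite -QE subrK.
Qed.

Lemma has_jet_near F G a d : 0 < d ->
  (forall h, normc h < d -> F (a + h) = G (a + h)) -> has_jet F a -> has_jet G a.
Proof.
move=> d0 FG [P [B [e [B0 e0 H]]]]; exists P, B, (Num.min d e); split=> //.
  by rewrite lt_min d0.
by move=> h; rewrite lt_min => /andP[hd he]; rewrite -FG// H.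
Qed.

Lemma has_jet_poly (P : {poly C}) a : has_jet (fun w => P.[w]) a.
Proof.
exists (P \Po ('X + a%:P)), 0, 1; split=> // h _.
by rewrite horner_comp hornerD hornerX hornerC [h + a]addrC subrr normc0 mul0r.
Qed.

Lemma has_jetB F a (c : C) : has_jet F a -> has_jet (fun w => F w - c) a.
Proof.
move=> [P [B [d [B0 d0 H]]]]; exists (P - c%:P), B, d; split=> // h hd.
by rewrite hornerD hornerN hornerC opprB addrA subrK H.
Qed.

Lemma has_jetM F G a : has_jet F a -> has_jet G a ->
  has_jet (fun w => F w * G w) a.
Proof.
move=> [P [B [d [B0 d0 HF]]]] [Q [D [e [D0 e0 HG]]]].
have [BP BP0 HP] := poly_bounded P; have [BQ BQ0 HQ] := poly_bounded Q.
exists (P * Q), (B * (D + BQ) + BP * D), (Num.min 1 (Num.min d e)); split.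
- by rewrite addr_ge0 ?mulr_ge0 ?addr_ge0.
- by rewrite !lt_min ltr01 d0.
move=> h; rewrite !lt_min => /and3P[h1 hd he]; rewrite hornerM.
have h0 := normc_ge0 h.
have h4 : normc h ^+ 4 <= 1 by rewrite exprn_ile1// ltW.
have h40 : 0 <= normc h ^+ 4 by rewrite exprn_ge0.
rewrite (_ : _ - _ = (F (a + h) - P.[h]) * ((G (a + h) - Q.[h]) + Q.[h])
  + P.[h] * (G (a + h) - Q.[h])); last by ring.
rewrite (_ : _ * _ ^+ 4 = B * normc h ^+ 4 * (D + BQ) + BP * (D * normc h ^+ 4)); last by ring.
apply: le_trans (normcD _ _) _; rewrite !normcM.
apply: lerD; last by apply: ler_pM; rewrite ?normc_ge0 ?HP ?HG// ltW.
apply: ler_pM; rewrite ?normc_ge0 ?HF//.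
apply: le_trans (normcD _ _) _; apply: lerD; last by rewrite HQ// ltW.
by apply: le_trans (HG _ he) _; rewrite ler_piMr.
Qed.

Lemma has_jetX F a m : has_jet F a -> has_jet (fun w => F w ^+ m) a.
Proof.
move=> jF; elim: m => [|m IH].
  apply: (has_jet_near ltr01 _ (has_jet_poly 1%:P a)) => h _.
  by rewrite hornerC expr0.
apply: (has_jet_near ltr01 _ (has_jetM jF IH)) => h _.
by rewrite exprS.
Qed.

Lemma has_jet_inv a p : a != p -> has_jet (fun w => (w - p)^-1) a.
Proof.
rewrite -subr_eq0 => b0; set b := a - p in b0.
have nb : 0 < normc b by rewrite normc_gt0.
(* Truncated geometric series of 1 / (b + h): the remainder is exactly h^4 b^-4 / (b + h), and |b +
   h| >= |b| / 2 on the chosen disc. *)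
exists (\poly_(i < 4) ((-1) ^+ i * b^-1 ^+ i.+1)), (2 * (normc b)^-1 ^+ 5), (normc b / 2).
split; [by rewrite mulr_ge0// exprn_ge0// invr_ge0 ltW|by rewrite divr_gt0|].
move=> h hb; have bh : normc b / 2 <= normc (b + h).
  have := distcD (b + h) b 0; rewrite !subr0 opprD addrA subrr sub0r normcN; lra.
have bh0 : b + h != 0 by rewrite -normc_gt0; apply: lt_le_trans bh; rewrite divr_gt0.
rewrite horner_poly (_ : _ - _ = h ^+ 4 * b^-1 ^+ 4 * (b + h)^-1); last first.
  rewrite !big_ord_recr big_ord0 /= (_ : a + h - p = b + h) /b; last by ring.
  by rewrite -/b; field; rewrite bh0.
rewrite normcM (normcM (h ^+ 4)) !normcX !normcV.
have iv : (normc (b + h))^-1 <= 2 * (normc b)^-1.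
  have -> : 2 * (normc b)^-1 = (normc b / 2)^-1 by rewrite invfM invrK mulrC.
  by rewrite lef_pV2 ?posrE ?normc_gt0// divr_gt0.
have h4 : 0 <= normc h ^+ 4 * (normc b)^-1 ^+ 4.
  by rewrite mulr_ge0 ?exprn_ge0 ?invr_ge0 ?normc_ge0.
rewrite [leRHS](_ : _ = normc h ^+ 4 * (normc b)^-1 ^+ 4 * (2 * (normc b)^-1)).
  by rewrite ler_wpM2l.
by ring.
Qed.

Lemma has_jet_cvg F a : has_jet F a -> forall e, 0 < e -> exists2 d, 0 < d &
  forall h, normc h < d -> normc (F (a + h) - F a) < e.
Proof.
move=> [P [B [d [B0 d0 H]]]] e e0.
have FP := jet_value d0 H.
have [Q QE] := poly_split0 P.
have [D D0 HD] := poly_bounded Q.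
exists (Num.min (Num.min 1 d) (e / (B + D + 1))).
  by rewrite !lt_min ltr01 d0 divr_gt0// ltr_wpDl// addr_ge0.
move=> h; rewrite !lt_min => /andP[/andP[h1 hd] he].
have h0 := normc_ge0 h.
have -> : F (a + h) - F a = (F (a + h) - P.[h]) + Q.[h] * h.
  by rewrite FP {2}QE !hornerE; ring.
apply: le_lt_trans (normcD _ _) _; rewrite normcM.
have hh : B * normc h ^+ 4 <= B * normc h.
  by rewrite ler_wpM2l// exprS ler_piMr// exprn_ile1// ltW.
have := H _ hd; have := ler_wpM2r h0 (HD _ (ltW h1)).
rewrite ltr_pdivlMr in he; last by rewrite ltr_wpDl// addr_ge0.
nra.
Qed.

Lemma sum_fourth_roots (F : comNzRingType) (j : F) : j * j = -1 ->
  [/\ 1 + (-1) ^+ 1 + j ^+ 1 + (- j) ^+ 1 = 0,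
      1 + (-1) ^+ 2 + j ^+ 2 + (- j) ^+ 2 = 0 &
      1 + (-1) ^+ 3 + j ^+ 3 + (- j) ^+ 3 = 0].
Proof.
move=> j2; split; [ring| |ring].
by rewrite !expr2 mulrNN mulrNN j2; ring.
Qed.

(** Degrees 1, 2, 3 cancel over the four directions, the constant term cancels against [4 * P.[0]],
    and a monomial of degree at least 4 contributes at most 4 s^4 times its coefficient because s <=
    1. *)
Lemma sum4_poly (P : {poly C}) : exists2 B : R, 0 <= B & forall s : R, 0 <= s <= 1 ->
  forall t : C, t = s%:C%C ->
  normc (P.[t] + P.[- t] + P.['i%C * t] + P.[- ('i%C * t)] - 4 * P.[0])
    <= B * s ^+ 4.
Proof.
exists (\sum_(k < size P) normc P`_k * 4).
  by apply: sumr_ge0 => k _; rewrite mulr_ge0// normc_ge0.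
have i2 : 'i%C * 'i%C = -1 :> C by rewrite -expr2 sqr_i.
have n1 : normc ('i%C : C) = 1 by rewrite /= expr0n add0r expr1n sqrtr1.
move: ('i%C : C) i2 n1 => I i2 n1 s /andP[s0 s1] t tE.
rewrite !horner_coef mulr_sumr -!big_split /= -sumrB mulr_suml.
apply: le_trans (normc_sum _ _ _) _; apply: ler_sum => k _.
have -> : P`_k * t ^+ k + P`_k * (- t) ^+ k + P`_k * (I * t) ^+ k +
   P`_k * (- (I * t)) ^+ k - 4 * (P`_k * 0 ^+ k) =
   P`_k * ((1 + (-1) ^+ k + I ^+ k + (- I) ^+ k) * t ^+ k - 4 * 0 ^+ k).
  by rewrite -mulNr exprMn exprMn -[in (- t) ^+ k]mulN1r exprMn; ring.
rewrite normcM -mulrA ler_wpM2l ?normc_ge0//.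
case: (nat_of_ord k) => [|[|[|[|j]]]].
- by rewrite !expr0 !mulr1 (_ : _ - _ = 0) ?normc0 ?mulr_ge0 ?exprn_ge0//; ring.
- have [-> _ _] := sum_fourth_roots i2.
  by rewrite mul0r mulr0 subrr normc0 mulr_ge0 ?exprn_ge0.
- have [_ -> _] := sum_fourth_roots i2.
  by rewrite mul0r expr0n mulr0 subrr normc0 mulr_ge0 ?exprn_ge0.
- have [_ _ ->] := sum_fourth_roots i2.
  by rewrite mul0r expr0n mulr0 subrr normc0 mulr_ge0 ?exprn_ge0.
rewrite expr0n mulr0 subr0 normcM normcX tE normc_real ger0_norm//.
apply: ler_pM; rewrite ?normc_ge0 ?exprn_ge0//; last first.
  by rewrite -(addn4 j) exprD ler_piMl ?exprn_ge0// exprn_ile1.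
have N1 m : normc ((-1 : C) ^+ m) = 1 by rewrite normcX normcN normc1 expr1n.
apply: le_trans (normcD _ _) _; rewrite !normcX normcN n1 expr1n.
rewrite (_ : 4 = 3 + 1); last by ring.
rewrite lerD2r; apply: le_trans (normcD _ _) _; rewrite normcX n1 expr1n.
rewrite (_ : 3 = 2 + 1); last by ring.
rewrite lerD2r; apply: le_trans (normcD _ _) _; rewrite N1 normc1.
lra.
Qed.

(* A point where [normc F + e * normc z ^+ 2] is maximal cannot be interior: its
   mean over [a + s], [a - s], [a + i s], [a - i s] exceeds the value at [a] by
   [e * s ^+ 2] up to O(s^4), since [1 + i^k + (-1)^k + (-i)^k = 0] for k = 1, 2, 3. *)
Lemma max_principle (K Bd : set C) F M :
  compact (K : set C^o) -> (forall z, K z -> normc z <= 1) ->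
  (forall z, K z -> has_jet F z) ->
  (forall z, K z -> ~ Bd z ->
     exists2 d, 0 < d & forall h, normc h < d -> K (z + h)) ->
  (forall z, K z -> Bd z -> normc (F z) <= M) ->
  forall z, K z -> normc (F z) <= M.
Proof.
move=> cK K1 jF Kint bF z0 Kz0; rewrite leNgt; apply/negP => Mz0.
(* Half the excess: as [normc z <= 1] on [K], the perturbation adds at most [e], so [u] on the
   boundary stays below [normc (F z0) <= u z0]. *)
pose e := (normc (F z0) - M) / 2.
have e0 : 0 < e by rewrite divr_gt0// subr_gt0.
have eE : 2 * e = normc (F z0) - M by rewrite mulrC divfK.
clearbody e.
pose u z := normc (F z) + e * normc z ^+ 2.
have [|a Ka ua] := @compact_EVT_max C^o R u K (ex_intro _ z0 Kz0) cK.
  apply: (@continuous_in_subspaceT C^o R K u _) => z; rewrite inE => Kz.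
  apply: (proj2 (@cvgrPdist_lt _ R C^o (nbhs (z : C^o)) (nbhs_filter (z : C^o)) u (u z))) => r r0.
  have r2 : 0 < r / 2 by lra.
  have [d d0 Hd] := has_jet_cvg (jF z Kz) r2.
  (* With |z| <= 1 and |w| <= 2 the squares differ by at most three times |w - z|, so the
     perturbation varies by less than r / 2. *)
  apply/nbhs_normcP; exists (Num.min (Num.min d 1) (r / (6 * e))).
    by rewrite !lt_min d0 ltr01 divr_gt0// mulr_gt0.
  move=> w; rewrite !lt_min => /andP[/andP[wd w1]].
  rewrite ltr_pdivlMr ?mulr_gt0// => we.
  have := Hd _ wd; rewrite [z + _]addrC subrK distcC => Fd.
  have := distcD (F z) (F w) 0; have := distcD (F w) (F z) 0; rewrite !subr0.
  have := distcD z w 0; have := distcD w z 0; rewrite !subr0.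
  rewrite (distcC (F w)) (distcC z) /u.
  have := normc_ge0 z; have := normc_ge0 w; have := normc_ge0 (w - z).
  have := K1 _ Kz.
  move: (normc z) (normc w) (normc (w - z)) (normc (F z)) (normc (F w))
    (normc (F z - F w)) wd w1 we Fd => x y t X Y T wd w1 we Fd x1 t0 y0 x0 H1 H2 H3 H4.
  have sq : `|x ^+ 2 - y ^+ 2| <= 3 * t.
    rewrite subr_sqr normrM mulrC; apply: ler_pM => //.
      by rewrite ger0_norm; lra.
    by rewrite ler_norml; apply/andP; split; lra.
  have -> : X + e * x ^+ 2 - (Y + e * y ^+ 2) = (X - Y) + e * (x ^+ 2 - y ^+ 2) by ring.
  apply: le_lt_trans (ler_normD _ _) _; rewrite normrM (gtr0_norm e0).
  have : `|X - Y| <= T by rewrite ler_norml; apply/andP; split; lra.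
  have := ler_wpM2l (ltW e0) sq; lra.
rewrite inE /= in Ka.
have {}ua t : K t -> u t <= u a by move=> Kt; apply: ua; rewrite inE.
have uz0 := ua _ Kz0.
have u0 : normc (F z0) <= u z0 by rewrite lerDl mulr_ge0 ?exprn_ge0 ?normc_ge0 ?ltW.
have [Ba|nBa] := pselect (Bd a).
  have := bF _ Ka Ba; have : e * normc a ^+ 2 <= e.
    by rewrite ler_piMr ?(ltW e0)// exprn_ile1 ?normc_ge0 ?K1.
  by move: uz0 u0 Mz0; rewrite {2}/u; lra.
have [d1 d10 Kd] := Kint _ Ka nBa.
have [P [B [d2 [B0 d20 HP]]]] := jF _ Ka.
have FP := jet_value d20 HP.
have [D D0 HD] := sum4_poly P.
(* The last bound makes the errors in s^4, [4 * B] from the jet at four points and [D] from the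
   averaging, smaller than the gain [4 * e * s ^+ 2]; the others keep the four points in [K] and in
   the disc of the jet. *)
pose s := Num.min (Num.min (1 / 2) (d1 / 2)) (Num.min (d2 / 2) (e / (4 * B + D + 1))).
have q0 : 0 < 4 * B + D + 1 by lra.
have s0 : 0 < s by rewrite /s !lt_min; do ?[apply/andP; split]; apply: divr_gt0 => //; lra.
have s1 : s <= 1 / 2 by rewrite /s !ge_min lexx.
have sd1 : s <= d1 / 2 by rewrite /s !ge_min lexx ?orbT.
have sd2 : s <= d2 / 2 by rewrite /s !ge_min lexx ?orbT.
have se : s <= e / (4 * B + D + 1) by rewrite /s !ge_min lexx ?orbT.
rewrite ler_pdivlMr// in se.
have s01 : 0 <= s <= 1 by lra.
pose t : C := s%:C%C; have HD' := HD s s01 t erefl.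
have nt : normc t = s by rewrite normc_real gtr0_norm.
have nit : normc ('i%C * t) = s.
  by rewrite normcM nt /= expr0n add0r expr1n sqrtr1 mul1r.
have step h : normc h = s -> normc P.[h] <= u a - e * normc (a + h) ^+ 2 + B * s ^+ 4.
  move=> hs; have h2 : normc h < d2 by rewrite hs; lra.
  have := ua (a + h) (Kd h _); rewrite /u => HH; have {}HH := HH ltac:(rewrite hs; lra).
  have := HP h h2; rewrite hs distcC.
  have := distcD (F (a + h)) P.[h] 0; rewrite !subr0; lra.
have := step t nt; have := step _ nit.
have := step (- t); rewrite normcN => /(_ nt).
have := step (- ('i%C * t)); rewrite normcN => /(_ nit).
have : normc (a + t) ^+ 2 + normc (a - t) ^+ 2 + normc (a + 'i%C * t) ^+ 2
   + normc (a - 'i%C * t) ^+ 2 = 4 * normc a ^+ 2 + 4 * s ^+ 2.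
  rewrite /t; case: (a) => x y; simpc.
  by rewrite !normcC; ring.
have : 4 * normc (F a) <= normc P.[t] + normc P.[- t] + normc P.['i%C * t]
    + normc P.[- ('i%C * t)] + D * s ^+ 4.
  rewrite FP; move: HD'.
  move: P.[t] P.[- t] P.['i%C * t] P.[- ('i%C * t)] P.[0] => p1 p2 p3 p4 p0 HD'.
  have -> : 4 * normc p0 = normc (4 * p0).
    rewrite normcM; congr (_ * _).
    have -> : (4 : C) = (4 : R)%:C%C by rewrite rmorph_nat.
    by rewrite normc_real ger0_norm.
  have -> : 4 * p0 = (p1 + p2 + p3 + p4) - (p1 + p2 + p3 + p4 - 4 * p0) by ring.
  apply: le_trans (normcB _ _) _; apply: lerD => //.
  by do 3 (apply: le_trans (normcD _ _) _; rewrite ?lerD2r).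
rewrite /u => H1 H2 H3 H4 H5 H6.
have : e * (4 * normc a ^+ 2 + 4 * s ^+ 2) = e * normc (a + t) ^+ 2 +
   e * normc (a - t) ^+ 2 + e * normc (a + 'i%C * t) ^+ 2 + e * normc (a - 'i%C * t) ^+ 2 by rewrite -H2; ring.
move=> H7.
have s4 : (4 * B + D) * s ^+ 4 < 4 * e * s ^+ 2.
  have -> : s ^+ 4 = s ^+ 2 * s ^+ 2 by ring.
  rewrite mulrA ltr_pM2r ?exprn_gt0//.
  have s2 : s ^+ 2 <= s by rewrite expr2 ler_piMr//; lra.
  have : (4 * B + D) * s ^+ 2 <= (4 * B + D) * s by rewrite ler_wpM2l//; lra.
  lra.
lra.
Qed.

End Jets.

(** * Power series and derivatives *)

Section Taylor.
Context {R : realType}.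
Local Notation C := R[i].
Implicit Types (f : C -> C) (a z w h u v : C).

Lemma geom_half_sum (x : R) n : 0 <= x <= 1 / 2 -> \sum_(k < n) x ^+ k <= 2.
Proof.
move=> /andP[x0 x2]; elim: n => [|n IH]; first by rewrite big_ord0.
rewrite big_ord_recl /= expr0.
under eq_bigr do rewrite exprS.
rewrite -mulr_sumr; have : 0 <= \sum_(k < n) x ^+ k by apply: sumr_ge0 => k _; exact: exprn_ge0.
by nra.
Qed.

(** Convergence at the single point [h = d] bounds the coefficients: late terms are differences of
    consecutive partial sums within 1 of the limit, hence at most 2, and the finitely many earlier
    terms are added to the bound. *)
Lemma analytic_taylor f a : analytic_at f a ->
  exists c : nat -> C, exists d : R, exists B : R,
  [/\ 0 < d, 0 <= B, forall k, normc (c k) * d ^+ k <= B &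
   forall h, normc h <= d -> forall e, 0 < e -> exists N, forall n, (N <= n)%N ->
     normc (\sum_(k < n) c k * h ^+ k - f (a + h)) < e].
Proof.
move=> [c /nbhs_normcP[d0 d00 Hc]]; pose d := d0 / 2.
have d_gt0 : 0 < d by rewrite divr_gt0.
have cvg h : normc h <= d -> forall e, 0 < e -> exists N, forall n, (N <= n)%N ->
     normc (\sum_(k < n) c k * h ^+ k - f (a + h)) < e.
  move=> hd; have := Hc (a + h); rewrite [a + h - a]addrC addKr.
  have hd0 : normc h < d0 by rewrite /d in hd; lra.
  move=> /(_ hd0)/cvg_normcP H e e0; have [N HN] := H e e0.
  by exists N => n Nn; have := HN n Nn; rewrite big_mkord.
have nd : normc (d%:C%C : C) = d by rewrite normc_real gtr0_norm.
have [|N HN] := cvg d%:C%C _ 1 ltr01; first by rewrite nd.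
pose t k := normc (c k) * d ^+ k.
have t0 k : 0 <= t k by rewrite mulr_ge0 ?normc_ge0 ?exprn_ge0 ?ltW.
exists c, d, (2 + \sum_(k < N) t k); split=> //; first by rewrite addr_ge0 ?sumr_ge0.
move=> k; have [kN|Nk] := ltnP k N.
  rewrite -/(t k) (bigD1 (Ordinal kN))//=.
  have : 0 <= \sum_(i < N | i != Ordinal kN) t i by exact: sumr_ge0.
  by lra.
have := HN _ Nk; have := HN _ (leqW Nk); rewrite big_ord_recr /=.
set S := \sum_(_ < k) _ => H1 H2.
have : normc (c k * d%:C%C ^+ k) <= 2.
  rewrite (_ : c k * _ = (S + c k * d%:C%C ^+ k - f (a + d%:C%C)) - (S - f (a + d%:C%C))); last by ring.
  by apply: le_trans (normcB _ _) _; lra.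
rewrite normcM normcX nd.
have : 0 <= \sum_(k < N) t k by exact: sumr_ge0.
by lra.
Qed.

(** On half the radius, the terms of degree at least 4 are dominated by |h|^4 times a geometric
    series of ratio at most 1/2. *)
Lemma analytic_jet f a : analytic_at f a -> has_jet f a.
Proof.
move=> /analytic_taylor[c [d [B [d0 B0 cB cvg]]]].
exists (\poly_(k < 4) c k), (2 * B / d ^+ 4), (d / 2).
have d4 : 0 < d ^+ 4 by rewrite exprn_gt0.
split; [by rewrite divr_ge0 ?mulr_ge0// ltW|by lra|].
move=> h hd; apply/ler_addgt0Pr => e e0.
have hd' : normc h <= d by lra.
have [N HN] := cvg h hd' e e0.
have := HN _ (leq_addl 4%N N); rewrite addnC -(addnC 4%N).
rewrite big_split_ord /= horner_poly.
set S4 := \sum_(i < 4) c i * h ^+ i.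
rewrite -/S4.
set T := \sum_(i < N) _ => H.
have TB : normc T <= 2 * B / d ^+ 4 * normc h ^+ 4.
  apply: le_trans (normc_sum _ _ _) _.
  have h0 := normc_ge0 h.
  apply: (@le_trans _ _ (\sum_(i < N) (B * (normc h ^+ 4 / d ^+ 4)) * (normc h / d) ^+ i)).
    apply: ler_sum => i _; rewrite normcM normcX /=.
    rewrite [leRHS](_ : _ = B / d ^+ (4 + i) * normc h ^+ (4 + i)); last first.
      by rewrite expr_div_n !(exprD _ 4 i) [(d ^+ 4 * d ^+ i)^-1]invfM; ring.
    by rewrite ler_wpM2r ?exprn_ge0// ler_pdivlMr ?exprn_gt0.
  rewrite -mulr_sumr.
  have x2 : 0 <= normc h / d <= 1 / 2.
    by rewrite divr_ge0 ?(ltW d0)//= ler_pdivrMr//; lra.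
  rewrite [leRHS](_ : _ = B * (normc h ^+ 4 / d ^+ 4) * 2); last by ring.
  rewrite ler_wpM2l ?geom_half_sum// mulr_ge0// divr_ge0// ?exprn_ge0// ltW//.
rewrite (_ : f (a + h) - S4 = T - (S4 + T - f (a + h))); last by ring.
by apply: le_trans (normcB _ _) _; lra.
Qed.

(* [divdiff v u k] is [(v ^+ k - u ^+ k) / (v - u)], also meaningful at [v = u]. *)
Fixpoint divdiff (v u : C) k : C :=
  if k is k'.+1 then v * divdiff v u k' + u ^+ k' else 0.

Lemma divdiff0 v u : divdiff v u 0 = 0.
Proof. by []. Qed.

Lemma divdiffS v u k : divdiff v u k.+1 = v * divdiff v u k + u ^+ k.
Proof. by []. Qed.

Lemma divdiffE v u k : (v - u) * divdiff v u k = v ^+ k - u ^+ k.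
Proof.
elim: k => [|k IH] /=; first by rewrite mulr0 !expr0 subrr.
by rewrite mulrDr mulrCA IH !exprS; ring.
Qed.

Lemma divdiff_bound (s : R) v u k : 0 <= s -> normc v <= s -> normc u <= s ->
  s * normc (divdiff v u k) <= (2 * s) ^+ k.
Proof.
move=> s0 vs us; elim: k => [|k IH]; first by rewrite divdiff0 normc0 mulr0 expr0 ler01.
rewrite divdiffS; have := normcD (v * divdiff v u k) (u ^+ k).
rewrite normcM normcX => H.
have uk : normc u ^+ k <= s ^+ k by rewrite lerXn2r ?nnegrE ?normc_ge0.
have sk : s ^+ k <= (2 * s) ^+ k by rewrite lerXn2r ?nnegrE; lra.
have vd : normc v * (s * normc (divdiff v u k)) <= s * (2 * s) ^+ k.
  by apply: ler_pM => //; rewrite ?mulr_ge0 ?normc_ge0.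
apply: le_trans (ler_wpM2l s0 H) _; rewrite exprS.
have := ler_wpM2l s0 (le_trans uk sk); lra.
Qed.

Lemma divdiff_lip (s : R) v w u k : 0 <= s -> normc v <= s -> normc w <= s ->
  normc u <= s ->
  s ^+ 2 * normc (divdiff v u k - divdiff w u k) <= (4 * s) ^+ k * normc (v - w).
Proof.
move=> s0 vs ws us; elim: k => [|k IH].
  by rewrite !divdiff0 subr0 normc0 mulr0 expr0 mul1r normc_ge0.
rewrite !divdiffS (_ : _ - _ = v * (divdiff v u k - divdiff w u k) + (v - w) * divdiff w u k); last by ring.
have := normcD (v * (divdiff v u k - divdiff w u k)) ((v - w) * divdiff w u k).
rewrite !normcM => H; apply: le_trans (ler_wpM2l _ H) _; first by rewrite exprn_ge0.
rewrite mulrDr.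
have A1 : normc v * (s ^+ 2 * normc (divdiff v u k - divdiff w u k)) <= s * ((4 * s) ^+ k * normc (v - w)).
  by apply: ler_pM; rewrite ?mulr_ge0 ?exprn_ge0 ?normc_ge0.
have A2 : s * normc (divdiff w u k) <= (4 * s) ^+ k.
  apply: le_trans (divdiff_bound k s0 ws us) _.
  by rewrite lerXn2r ?nnegrE; lra.
have A3 := ler_wpM2l (mulr_ge0 s0 (normc_ge0 (v - w))) A2.
have A4 : 0 <= s * ((4 * s) ^+ k * normc (v - w)).
  by rewrite !mulr_ge0 ?exprn_ge0 ?normc_ge0 ?mulr_ge0.
rewrite [(4 * s) ^+ k.+1]exprS; move: ((4 * s) ^+ k) A1 A2 A3 A4 => X A1 A2 A3 A4.
move: (normc (divdiff v u k - divdiff w u k)) (normc (divdiff w u k)) A1 A2 A3 => Y Z A1 A2 A3.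
by lra.
Qed.

(** Lipschitz continuity of divided differences, multiplied out so that points may coincide. It
    holds for partial sums uniformly in their length, and passes to [f] up to [e]. *)
Lemma analytic_divdiff f a : analytic_at f a ->
  exists d : R, exists K : R, [/\ 0 < d, 0 <= K &
   forall u v w, normc (u - a) <= d -> normc (v - a) <= d -> normc (w - a) <= d ->
   normc ((f v - f u) * (w - u) - (f w - f u) * (v - u)) <=
     K * (normc (v - w) * normc (v - u) * normc (w - u))].
Proof.
move=> /analytic_taylor[c [d [B [d0 B0 cB cvg]]]].
(* Then [4 * s = d / 2], so [divdiff_lip] and the coefficient bound yield a geometric series of
   ratio 1/2. *)
pose s := d / 8; have s0 : 0 < s by rewrite divr_gt0.
exists s, (2 * B / s ^+ 2); split=> //.
  by rewrite divr_ge0 ?mulr_ge0 ?exprn_ge0// ltW.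
move=> u v w ua va wa; apply/ler_addgt0Pr => e e0.
pose q := 2 * normc (w - u) + 2 * normc (v - u) + 1.
have q0 : 0 < q by rewrite /q; have := normc_ge0 (w - u); have := normc_ge0 (v - u); lra.
have eq0 : 0 < e / q by rewrite divr_gt0.
have C' x : normc (x - a) <= s -> exists N, forall n, (N <= n)%N ->
     normc (\sum_(k < n) c k * (x - a) ^+ k - f x) < e / q.
  move=> xs; have xd : normc (x - a) <= d by rewrite /s in xs; lra.
  by have := cvg _ xd _ eq0; rewrite [a + _]addrC subrK.
have [N1 H1] := C' _ ua; have [N2 H2] := C' _ va; have [N3 H3] := C' _ wa.
pose n := (N1 + N2 + N3)%N.
have {H1} := H1 n ltac:(by rewrite /n -addnA leq_addr).
have {H2} := H2 n ltac:(by rewrite /n addnAC leq_addl).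
have {H3} := H3 n ltac:(by rewrite /n leq_addl).
set Sw := \sum_(_ < n) _; set Sv := \sum_(_ < n) _; set Su := \sum_(_ < n) _.
move=> H3 H2 H1.
have main : normc ((Sv - Su) * (w - u) - (Sw - Su) * (v - u)) <=
    2 * B / s ^+ 2 * (normc (v - w) * normc (v - u) * normc (w - u)).
  have -> : (Sv - Su) * (w - u) - (Sw - Su) * (v - u) =
      (v - u) * (w - u) * \sum_(k < n) c k * (divdiff (v - a) (u - a) k - divdiff (w - a) (u - a) k).
    rewrite -!sumrB !mulr_suml -sumrB mulr_sumr; apply: eq_bigr => k _.
    rewrite -!mulrBr -!divdiffE; ring.
  rewrite !normcM.
  have : normc (\sum_(k < n) c k * (divdiff (v - a) (u - a) k - divdiff (w - a) (u - a) k))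
     <= 2 * B / s ^+ 2 * normc (v - w).
    apply: le_trans (normc_sum _ _ _) _.
    apply: (@le_trans _ _ (\sum_(k < n) (B / s ^+ 2 * normc (v - w)) * (1 / 2) ^+ k)).
      apply: ler_sum => k _; rewrite normcM.
      have s2 : 0 < s ^+ 2 by rewrite exprn_gt0.
      have L := divdiff_lip k (ltW s0) va wa ua.
      rewrite (_ : v - a - (w - a) = v - w) in L; last by ring.
      have s4 : 4 * s = d * (1 / 2) by rewrite /s; field.
      rewrite mulrC s4 (exprMn k d) in L.
      rewrite -ler_pdivlMr// in L.
      apply: le_trans (ler_wpM2l (normc_ge0 _) L) _.
      rewrite [leLHS](_ : _ = normc (c k) * d ^+ k * ((s ^+ 2)^-1 * normc (v - w) * (1 / 2) ^+ k)); last by ring.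
      rewrite [leRHS](_ : _ = B * ((s ^+ 2)^-1 * normc (v - w) * (1 / 2) ^+ k)); last by ring.
      rewrite ler_wpM2r// !mulr_ge0 ?normc_ge0 ?invr_ge0 ?exprn_ge0 ?ltW//; lra.
    rewrite -mulr_sumr.
    have h2 : 0 <= (1 / 2 : R) <= 1 / 2 by lra.
    rewrite [leRHS](_ : _ = B / s ^+ 2 * normc (v - w) * 2); last by ring.
    by rewrite ler_wpM2l ?geom_half_sum// mulr_ge0 ?divr_ge0 ?exprn_ge0 ?normc_ge0// ltW.
  move=> H.
  rewrite [leRHS](_ : _ = normc (v - u) * normc (w - u) * (2 * B / s ^+ 2 * normc (v - w))); last by ring.
  by rewrite ler_wpM2l// mulr_ge0 ?normc_ge0.
(* The three truncation errors, each below [e / q], carry a total weight below [q], so they cost at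
   most [e]. *)
rewrite (_ : _ - _ = ((Sv - Su) * (w - u) - (Sw - Su) * (v - u))
   - ((Sv - f v) * (w - u) - (Sw - f w) * (v - u) - (Su - f u) * (w - v))); last by ring.
apply: le_trans (normcB _ _) _; apply: lerD => //.
apply: le_trans (normcB _ _) _; apply: le_trans (lerD (normcB _ _) (lexx _)) _.
rewrite !normcM.
have wv : normc (w - v) <= normc (w - u) + normc (v - u) by rewrite (distcC v); exact: distcD.
have : e / q * (2 * normc (w - u) + 2 * normc (v - u)) <= e.
  rewrite mulrAC ler_pdivrMr// ler_wpM2l ?ltW// /q; lra.
have := ler_wpM2r (normc_ge0 (w - u)) (ltW H2).
have := ler_wpM2r (normc_ge0 (v - u)) (ltW H3).
have := ler_wpM2r (normc_ge0 (w - v)) (ltW H1).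
have := ler_wpM2l (ltW eq0) wv.
lra.
Qed.

(** Dividing the jet twice by ['X] isolates its linear coefficient [Q.[0]], which the quadratic
    estimate identifies with the limit defining the derivative. *)
Lemma jet_derive f a : has_jet f a ->
  exists B : R, exists d : R, [/\ 0 <= B, 0 < d & forall h, normc h < d ->
    normc (f (a + h) - f a - complex_derive f a * h) <= B * normc h ^+ 2].
Proof.
move=> [P [B [d [B0 d0 H]]]].
have fP := jet_value d0 H.
have [Q QE] := poly_split0 P.
have [Q2 Q2E] := poly_split0 Q.
have [D D0 HD] := poly_bounded Q2.
have key h : normc h < Num.min d 1 ->
    normc (f (a + h) - f a - Q.[0] * h) <= (B + D) * normc h ^+ 2.
  rewrite lt_min => /andP[hd h1]; have h0 := normc_ge0 h.
  have -> : f (a + h) - f a - Q.[0] * h = (f (a + h) - P.[h]) + Q2.[h] * h ^+ 2.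
    rewrite fP [in RHS]QE [Q in RHS]Q2E !hornerD !hornerM !hornerX !hornerC.
    by rewrite hornerD hornerM hornerX hornerC; ring.
  apply: le_trans (normcD _ _) _; rewrite mulrDl; apply: lerD.
    apply: le_trans (H _ hd) _; rewrite ler_wpM2l// (_ : 4 = 2 + 2)%N// exprD.
    by rewrite ler_piMl ?exprn_ge0// exprn_ile1// ltW.
  by rewrite normcM normcX ler_wpM2r ?exprn_ge0// HD// ltW.
have DQ : complex_derive f a = Q.[0].
  rewrite /complex_derive /derive.
  refine (@cvg_lim C^o _ C^o _ _ _ (Q.[0] : C^o) _).
    exact: (@norm_hausdorff _ C^o).
  move=> V /= /nbhs_normcP[r r0 HV]; apply/nbhs_normcP.
  exists (Num.min (Num.min d 1) (r / (B + D + 1))).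
    by rewrite !lt_min d0 ltr01 divr_gt0// ltr_wpDl// addr_ge0.
  move=> h; rewrite subr0 lt_min => /andP[hd hr] hn0; apply: HV.
  have nh0 : 0 < normc h by rewrite normc_gt0.
  rewrite /= (_ : _ - _ = h^-1 * (f (a + h) - f a - Q.[0] * h)); last first.
    by rewrite /GRing.scale /= mulr1 addrC [h + a]addrC; field.
  rewrite normcM normcV mulrC ltr_pdivrMr//.
  apply: le_lt_trans (key _ hd) _.
  rewrite ltr_pdivlMr in hr; last by rewrite ltr_wpDl// addr_ge0.
  by rewrite expr2 mulrA ltr_pM2r//; lra.
by exists (B + D), (Num.min d 1); rewrite DQ; split; [exact: addr_ge0|rewrite lt_min d0 ltr01|exact: key].
Qed.

Definition holomorphic f := forall z, unit_disc z -> analytic_at f z.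

Lemma unit_disc_ball a : unit_disc a -> exists2 d : R, 0 < d &
  forall w, normc (w - a) <= d -> unit_disc w.
Proof.
move=> /unit_discE a1; exists ((1 - normc a) / 2); first by lra.
move=> w wa; apply/unit_discE; have := distcD a w 0; rewrite !subr0; lra.
Qed.

(* The constant is uniform in [u], so exchanging [u] and [v] shows that the
   derivative is locally Lipschitz. *)
Lemma holomorphic_strict f a : holomorphic f -> unit_disc a ->
  exists d : R, exists K : R, [/\ 0 < d, 0 <= K & forall u v,
    normc (u - a) <= d -> normc (v - a) <= d ->
    normc (f v - f u - complex_derive f u * (v - u)) <= K * normc (v - u) ^+ 2].
Proof.
move=> hf a1; have [d1 d10 D1] := unit_disc_ball a1.
have [d2 [K [d20 K0 HK]]] := analytic_divdiff (hf _ a1).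
pose d := Num.min d1 d2 / 2.
have md : 0 < Num.min d1 d2 by rewrite lt_min d10.
exists d, K; split=> //; first by rewrite divr_gt0.
move=> u v ua va.
have dd : d < d1 /\ d < d2.
  have : Num.min d1 d2 <= d1 by rewrite ge_min lexx.
  have : Num.min d1 d2 <= d2 by rewrite ge_min lexx orbT.
  by rewrite /d; lra.
have u1 : unit_disc u by apply: D1; lra.
have [B [d3 [B0 d30 HB]]] := jet_derive (analytic_jet (hf _ u1)).
set p := complex_derive f u in HB *.
apply/ler_addgt0Pr => e e0.
pose x := normc (v - u); have x0 : 0 <= x := normc_ge0 _.
(* The third point of the divided-difference estimate is [u + r], whose difference quotient
   approximates the derivative at [u]. The last bound keeps the error below [e] after the common
   factor [r] is cancelled. *)
pose r := Num.min (Num.min (d3 / 2) (d2 - d)) (e / ((K + B) * x + 1)).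
have q0 : 0 < (K + B) * x + 1 by rewrite ltr_wpDl// mulr_ge0// addr_ge0.
have r0 : 0 < r by rewrite !lt_min divr_gt0//= subr_gt0 divr_gt0// andbT; lra.
have rd3 : r < d3 by apply: (@le_lt_trans _ _ (d3 / 2)); [rewrite /r !ge_min lexx|lra].
have rd2 : r <= d2 - d by rewrite /r !ge_min lexx orbT.
have re : r * ((K + B) * x + 1) <= e by rewrite -ler_pdivlMr// /r !ge_min lexx orbT.
have nr : normc (r%:C%C : C) = r by rewrite normc_real gtr0_norm.
have := HB r%:C%C; rewrite nr => /(_ rd3) HB'.
have := HK u v (u + r%:C%C) _ _ _.
have -> : v - (u + r%:C%C) = (v - u) - r%:C%C by ring.
rewrite [u + _ - u]addrC addKr nr => HK'.
have {}HK' := HK' ltac:(lra) ltac:(lra) ltac:(have := normcD (u - a) r%:C%C; rewrite nr addrAC; lra).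
have vr : normc (v - u - r%:C%C) <= x + r by rewrite -[in leRHS]nr; exact: normcB.
have : normc (f v - f u - p * (v - u)) * r <= K * ((x + r) * x * r) + B * r ^+ 2 * x.
  rewrite -[in leLHS]nr -normcM.
  rewrite (_ : (f v - f u - p * (v - u)) * _ = ((f v - f u) * r%:C%C - (f (u + r%:C%C) - f u) * (v - u))
      + (f (u + r%:C%C) - f u - p * r%:C%C) * (v - u)); last by ring.
  apply: le_trans (normcD _ _) _; apply: lerD; last first.
    by rewrite normcM ler_wpM2r.
  apply: le_trans HK' _; rewrite ler_wpM2l// -/x (ler_wpM2r (ltW r0))//.
  by rewrite ler_wpM2r.
rewrite [X in _ <= X -> _](_ : _ = (K * x ^+ 2 + r * ((K + B) * x)) * r); last by ring.
rewrite ler_pM2r// -/x => Hx; apply: le_trans Hx _; rewrite lerD2l.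
by apply: le_trans re; rewrite mulrDr lerDl mulr1 ltW.
Qed.

End Taylor.

(** * Growth of functions of finite Dirichlet integral *)

Section PlaneMeasurability.
Context {R : realType}.

(** An open set is the union of the countably many rational squares that it contains. *)
Lemma open_prod_measurable (U : set (R * R)) : open U -> measurable U.
Proof.
move=> oU.
pose box (t : rat * rat * rat) : set (R * R) :=
  [set p | ratr t.1.1 - ratr t.2 < p.1 < ratr t.1.1 + ratr t.2 /\
           ratr t.1.2 - ratr t.2 < p.2 < ratr t.1.2 + ratr t.2].
have boxE t : box t =
    `]ratr t.1.1 - ratr t.2, ratr t.1.1 + ratr t.2[%classic `*`
    `]ratr t.1.2 - ratr t.2, ratr t.1.2 + ratr t.2[%classic.
  by apply/seteqP; split => p /=; rewrite !in_itv.
pose F t := if `[< box t `<=` U >] then box t else set0.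
have -> : U = \bigcup_t F t.
  apply/seteqP; split => [[x y] Uxy|p [t _]]; last first.
    by rewrite /F; case: asboolP => // + ?; apply.
  have /nbhs_ballP[e /= e0 He] : nbhs (x, y) U by exact: open_nbhs_nbhs.
  (* With the centre off by less than e / 4 in each coordinate and the half-side between e / 4 and e
     / 2, the square contains the point and stays within [e] of it. *)
  have [r] := rat_in_itvoo (ltac:(lra) : e / 4 < e / 2).
  rewrite in_itv/= => /andP[re4 re2].
  have [q1] := rat_in_itvoo (ltac:(lra) : x - e / 4 < x + e / 4).
  rewrite in_itv/= => /andP[q11 q12].
  have [q2] := rat_in_itvoo (ltac:(lra) : y - e / 4 < y + e / 4).
  rewrite in_itv/= => /andP[q21 q22].
  exists (q1, q2, r) => //; rewrite /F; case: asboolP => [_|nb].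
    by rewrite /box /=; split; apply/andP; split; lra.
  exfalso; apply: nb => -[x' y']; rewrite /box /= => -[/andP[h1 h2] /andP[h3 h4]].
  apply: He; split; rewrite /ball /=; rewrite ltr_norml; apply/andP; split; lra.
apply: countable_bigcupT_measurable => // t.
rewrite /F; case: asboolP => // _.
by rewrite boxE; apply: measurableX.
Qed.

Lemma open_continuous_prod_measurable (A : set (R * R)) (g : R * R -> R) :
  open A -> {in A, continuous g} -> measurable_fun A g.
Proof.
move=> oA cg; apply: (measurability _ (RGenOpens.measurableE R)).
move=> _ [_ [a [b ->] <-]]; apply: open_prod_measurable.
rewrite openE => p [Ap /= gp]; apply: filterI; first exact: open_nbhs_nbhs.
have := cg p; rewrite inE => /(_ Ap); apply.
by apply: open_nbhs_nbhs; split => //; exact: interval_open.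
Qed.

(** Shaped for G = |f'|^2: the inequality |f'| <= 1 + |f'|^2 takes the place of Cauchy-Schwarz. *)
Lemma ftc_bound (u u' G : R -> R) (a b K : R) : a < b ->
  (forall t, a <= t <= b -> is_derive t 1 u (u' t)) ->
  {within `[a, b], continuous u'} -> {within `[a, b], continuous G} ->
  (forall t, a <= t <= b -> `|u' t| <= 1 + G t) ->
  (forall t, a <= t <= b -> 0 <= G t) ->
  (\int[lebesgue_measure]_(t in `[a, b]) (G t)%:E <= K%:E)%E ->
  `|u b - u a| <= (b - a) + K.
Proof.
move=> ab du cu' cG uG G0 GK.
have E : (\int[lebesgue_measure]_(t in `[a, b]) (u' t)%:E = (u b)%:E - (u a)%:E)%E.
  apply: continuous_FTC2 => //.
    have cu t : a <= t <= b -> {for t, continuous u}.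
      move=> tab; apply: differentiable_continuous; apply/derivable1_diffP.
      by have [] := du t tab.
    split.
    - by move=> t; rewrite in_itv/= => /andP[? ?]; have [] := du t ltac:(lra).
    - by apply: cvg_at_right_filter; apply: cu; lra.
    - by apply: cvg_at_left_filter; apply: cu; lra.
  move=> t; rewrite in_itv/= => /andP[? ?]; rewrite derive1E.
  by have D := du t ltac:(lra); exact: derive_val.
have mI : measurable (`[a, b]%classic : set R) by exact: measurable_itv.
have mu' : measurable_fun (`[a, b]%classic : set R) (EFin \o u').
  by apply/measurable_EFinP; exact: subspace_continuous_measurable_fun.
have mG : measurable_fun (`[a, b]%classic : set R) (EFin \o G).
  by apply/measurable_EFinP; exact: subspace_continuous_measurable_fun.
rewrite -lee_fin.
have -> : (`|u b - u a|%:E = `|\int[lebesgue_measure]_(t in `[a, b]) (u' t)%:E|)%E.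
  by rewrite E -EFinB.
apply: (le_trans (le_abse_integral lebesgue_measure mI mu')).
apply: (@le_trans _ _ (\int[lebesgue_measure]_(t in `[a, b]) (1%:E + (G t)%:E))%E).
  apply: ge0_le_integral => //.
  - exact: measurableT_comp.
  - by apply: emeasurable_funD => //; exact: measurable_cst.
have -> : (\int[lebesgue_measure]_(t in `[a, b]) (1%:E + (G t)%:E) =
    \int[lebesgue_measure]_(t in `[a, b]) (cst 1%:E t) +
    \int[lebesgue_measure]_(t in `[a, b]) (G t)%:E)%E.
  by apply: ge0_integralD.
rewrite EFinD; apply: leeD => //.
have mab : lebesgue_measure (`[a, b]%classic : set R) = (b - a)%:E.
  by rewrite lebesgue_measure_itv/= lte_fin ab EFinB.
by rewrite integral_cst// mul1e le_eqVlt; apply/orP; left; apply/eqP; exact: mab.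
Qed.

End PlaneMeasurability.

(** * The Dirichlet integral and its sections along lines *)

Section Energy.
(* Otherwise [ring] and [lra] unfold the limit when they compare atoms. *)
Local Opaque complex_derive.
Context {R : realType}.
Local Notation C := R[i].
Implicit Types (f : C -> C) (a z u v : C).

Lemma lipschitz_at_continuous (u : R -> R) (t d K : R) : 0 < d -> 0 <= K ->
  (forall s, `|s - t| < d -> `|u s - u t| <= K * `|s - t|) ->
  {for t, continuous u}.
Proof.
move=> d0 K0 H; apply/cvgrPdist_lt => e e0.
have q0 : 0 < K + 1 by lra.
apply/nbhs_ballP; exists (Num.min d (e / (K + 1))).
  by rewrite /= lt_min d0 divr_gt0.
move=> s; rewrite /ball /= distrC lt_min => /andP[sd].
rewrite ltr_pdivlMr// => se.
rewrite distrC; apply: le_lt_trans (H _ sd) _; have := normr_ge0 (s - t); lra.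
Qed.

Lemma quadratic_is_derive (u : R -> R) (t d K l : R) : 0 < d -> 0 <= K ->
  (forall h, `|h| < d -> `|u (t + h) - u t - l * h| <= K * h ^+ 2) ->
  is_derive t 1 u l.
Proof.
move=> d0 K0 H.
have q0 : 0 < K + 1 by lra.
have cv : h^-1 *: ((u \o shift t) (h *: 1) - u t) @[h --> 0^'] --> l.
  move=> V /= /nbhs_ballP[e /= e0 HV]; apply/nbhs_ballP.
  exists (Num.min d (e / (K + 1))); first by rewrite /= lt_min d0 divr_gt0.
  move=> h; rewrite /ball /= sub0r normrN lt_min => /andP[hd].
  rewrite ltr_pdivlMr// => he hn0; apply: HV; rewrite /ball /=.
  have nh0 : 0 < `|h| by rewrite normr_gt0.
  have -> : l - h^-1 *: (u (h *: 1 + t) - u t) =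
      - (h^-1 * (u (t + h) - u t - l * h)).
    by rewrite /GRing.scale /= mulr1 [h + t]addrC; field.
  rewrite normrN normrM normfV mulrC ltr_pdivrMr//.
  apply: le_lt_trans (H _ hd) _.
  by rewrite -[h ^+ 2]real_normK ?num_real// expr2 mulrA ltr_pM2r//; lra.
apply: DeriveDef; first by apply/cvg_ex; exists l.
exact: (@cvg_lim R).
Qed.

Lemma derive_lipschitz f a : holomorphic f -> unit_disc a ->
  exists d : R, exists K : R, [/\ 0 < d, 0 <= K & forall u,
    normc (u - a) <= d ->
    normc (complex_derive f u - complex_derive f a) <= K * normc (u - a)].
Proof.
move=> hf a1; have [d [K [d0 K0 H]]] := holomorphic_strict hf a1.
exists d, (K + K); split=> //; first by rewrite addr_ge0.
move=> u ua; have [->|ne] := eqVneq u a; first by rewrite !subrr normc0 mulr0.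
have n0 : 0 < normc (u - a) by rewrite normc_gt0 subr_eq0.
have aa : normc (a - a) <= d by rewrite subrr normc0 ltW.
have H1 := H _ _ ua aa; have H2 := H _ _ aa ua.
rewrite (distcC a) in H1.
rewrite -(ler_pM2r n0) -normcM.
move: (complex_derive f u) (complex_derive f a) H1 H2 => p q H1 H2.
rewrite (_ : (p - q) * (u - a) = (f a - f u - p * (a - u))
    + (f u - f a - q * (u - a))); last by ring.
by apply: le_trans (normcD _ _) _; lra.
Qed.

(** [ftc_bound] is applied to the real and the imaginary part of [f] along the segment; adding the
    two estimates gives the factor 2. *)
Lemma segment_bound f (p q : C) (a b K : R) : holomorphic f -> normc q = 1 ->
  a < b -> (forall t, a <= t <= b -> unit_disc (p + q * t%:C%C)) ->
  (\int[lebesgue_measure]_(t in `[a, b])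
     (normc (complex_derive f (p + q * t%:C%C)) ^+ 2)%:E <= K%:E)%E ->
  normc (f (p + q * b%:C%C) - f (p + q * a%:C%C)) <= 2 * (b - a + K).
Proof.
move=> hf q1 ab disc gK.
pose g t := p + q * t%:C%C; pose D t := complex_derive f (g t).
have gB s t : g s - g t = q * (s - t)%:C%C by rewrite /g rmorphB; ring.
have ngB s t : normc (g s - g t) = `|s - t| by rewrite gB normcM q1 mul1r normc_real.
have Dlip t : a <= t <= b -> exists d : R, exists K : R, [/\ 0 < d, 0 <= K &
    forall s, `|s - t| < d -> normc (D s - D t) <= K * `|s - t|].
  move=> /disc dt; have [d [L [d0 L0 H]]] := derive_lipschitz hf dt.
  by exists d, L; split=> // s st; have := H (g s); rewrite ngB; apply; exact: ltW.
have cG : {within `[a, b], continuous (fun t => normc (D t) ^+ 2)}.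
  apply: continuous_in_subspaceT => t; rewrite inE/= in_itv/= => /Dlip[d [L [d0 L0 H]]].
  rewrite (_ : (fun t => _) = (fun t => normc (D t)) \* (fun t => normc (D t))); last first.
    by apply/funext => s /=; rewrite expr2.
  suff cD : {for t, continuous (fun t => normc (D t))} by apply: continuousM.
  apply: (lipschitz_at_continuous d0 L0) => s st.
  by apply: le_trans (H _ st); exact: dist_normc.
pose part (pr : C -> R) := [/\ forall z w, pr (z - w) = pr z - pr w,
   forall z (r : R), pr (z * r%:C%C) = pr z * r & forall z, `|pr z| <= normc z].
have key pr : part pr -> `|pr (f (g b)) - pr (f (g a))| <= b - a + K.
  move=> [prB prM prn].
  apply: (@ftc_bound _ (fun t => pr (f (g t))) (fun t => pr (D t * q))
     (fun t => normc (D t) ^+ 2)) => //.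
  - move=> t tab; have [d [L [d0 L0 H]]] := holomorphic_strict hf (disc t tab).
    apply: (@quadratic_is_derive _ t d L) => // h hd.
    have th : t + h - t = h by ring.
    have := H (g t) (g (t + h)); rewrite subrr normc0 !ngB th => HH.
    have {}HH := HH (ltW d0) (ltW hd).
    rewrite gB th mulrA real_normK ?num_real// in HH.
    by rewrite -prM -!prB; apply: le_trans (prn _) _.
  - apply: continuous_in_subspaceT => t; rewrite inE/= in_itv/= => /Dlip[d [L [d0 L0 H]]].
    apply: (lipschitz_at_continuous d0 L0) => s st.
    rewrite -prB; apply: le_trans (prn _) _.
    by rewrite -mulrBl normcM q1 mulr1 H.
  - move=> t tab; apply: le_trans (prn _) _.
    by rewrite normcM q1 mulr1; move: (normc (D t)) => y; have := sqr_ge0 (y - 1); nra.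
  - by move=> t _; exact: sqr_ge0.
have rp : part (@complex.Re R).
  split; [by case=> ? ? [? ?]|by case=> x y r /=; rewrite !mulr0 subr0|exact: normRe].
have ip : part (@complex.Im R).
  split; [by case=> ? ? [? ?]|by case=> x y r /=; rewrite !mulr0 add0r mulrC|exact: normIm].
have [rB _ _] := rp; have [iB _ _] := ip.
apply: le_trans (normc_le_ReIm _) _; rewrite rB iB.
by have := key _ rp; have := key _ ip; rewrite /g; lra.
Qed.

(** Extended by zero off the disc, so that Tonelli applies on the whole plane and whole lines can be
    integrated over. *)
Definition plane_energy f : R * R -> \bar R :=
  (fun p => (normc (complex_derive f (p.1 +i* p.2)%C) ^+ 2)%:E) \_
    [set p : R * R | unit_disc (p.1 +i* p.2)%C].

Lemma plane_energyE f x y : unit_disc (x +i* y)%C ->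
  plane_energy f (x, y) = (normc (complex_derive f (x +i* y)%C) ^+ 2)%:E.
Proof. by move=> d; rewrite /plane_energy patchE mem_set. Qed.

Lemma plane_energy_ge0 f p : (0 <= plane_energy f p)%E.
Proof.
by rewrite /plane_energy patchE; case: ifP => // _; rewrite lee_fin sqr_ge0.
Qed.

Lemma nbhs_plane (x y d : R) : 0 < d ->
  \forall p \near (x, y), normc ((p.1 +i* p.2)%C - (x +i* y)%C) < d.
Proof.
move=> d0; apply/nbhs_ballP; exists (d / 2); first by rewrite /= divr_gt0.
move=> [x' y'] [/=]; rewrite /ball /= => h1 h2.
change (normc ((x' +i* y')%C - (x +i* y)%C) < d).
apply: le_lt_trans (normc_le_ReIm _) _ => /=.
rewrite (distrC x') (distrC y'); lra.
Qed.

Lemma measurable_plane_energy f : holomorphic f ->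
  measurable_fun setT (plane_energy f).
Proof.
move=> hf.
have oA : open [set p : R * R | unit_disc (p.1 +i* p.2)%C].
  rewrite openE => -[x y] /= dxy; have [d d0 H] := unit_disc_ball dxy.
  have := nbhs_plane x y d0; apply: filterS => p /ltW; exact: H.
have mA := open_prod_measurable oA.
apply: (iffLR (measurable_restrictT _ mA)).
apply/measurable_EFinP; apply: open_continuous_prod_measurable => //.
move=> [x y]; rewrite inE /= => dxy.
pose D (p : R * R) := normc (complex_derive f (p.1 +i* p.2)%C).
rewrite (_ : (fun p => _) = D \* D); last by apply/funext => s /=; rewrite expr2.
suff cD : {for (x, y), continuous D} by apply: continuousM.
have [d [K [d0 K0 H]]] := derive_lipschitz hf dxy.
apply/cvgrPdist_lt => e e0.
have q0 : 0 < K + 1 by lra.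
have m0 : 0 < Num.min d (e / (K + 1)) by rewrite lt_min d0 divr_gt0.
have := nbhs_plane x y m0; apply: filterS => p; rewrite lt_min ltr_pdivlMr// => /andP[pd pe].
have := H _ (ltW pd) => {}H.
apply: (@le_lt_trans _ _ (K * normc ((p.1 +i* p.2)%C - (x +i* y)%C))); last first.
  have := normc_ge0 ((p.1 +i* p.2)%C - (x +i* y)%C); lra.
by apply: le_trans H; rewrite distcC; exact: dist_normc.
Qed.

Lemma dirichlet_energy f : dirichlet_space f -> holomorphic f /\
  exists2 D : R, 0 <= D &
   (\int[(lebesgue_measure \x lebesgue_measure)%E]_p plane_energy f p <= D%:E)%E.
Proof.
move=> [hf fin]; split=> //.
rewrite integral_mkcond -/(plane_energy f) in fin.
have I0 : (0 <= \int[(lebesgue_measure \x lebesgue_measure)%E]_p plane_energy f p)%E.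
  by apply: integral_ge0 => p _; exact: plane_energy_ge0.
move: I0 fin.
set I := (\int[_]_p _)%E; case: I => [r| |]//.
- by move=> r0 _; exists r => //; rewrite -lee_fin.
- by move=> _; rewrite mulry gtr0_sg ?invr_gt0 ?pi_gt0// mul1e ltxx.
Qed.

(** Chebyshev: were [F] larger throughout the interval, its integral would be at least [D + 1]. The
    added 1 makes the contradiction strict. *)
Lemma good_value (F : R -> \bar R) (a b D : R) : a < b ->
  measurable_fun setT F -> (forall x, 0 <= F x)%E ->
  (\int[lebesgue_measure]_x F x <= D%:E)%E ->
  exists2 x, a <= x <= b & (F x <= ((D + 1) / (b - a))%:E)%E.
Proof.
move=> ab mF F0 FD; apply: contrapT => nx.
have ba0 : 0 < b - a by lra.
have big x : x \in `[a, b] -> (((D + 1) / (b - a))%:E <= F x)%E.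
  move=> xab; rewrite leNgt; apply/negP => Fx; apply: nx; exists x; last exact: ltW.
  by rewrite in_itv/= in xab.
have D0 : 0 <= D by rewrite -lee_fin (le_trans _ FD)// integral_ge0.
have mab : lebesgue_measure (`[a, b]%classic : set R) = (b - a)%:E.
  by rewrite lebesgue_measure_itv/= lte_fin ab EFinB.
have mI : measurable (`[a, b]%classic : set R) by exact: measurable_itv.
have : ((D + 1)%:E <= D%:E)%E; last by rewrite lee_fin; lra.
apply: le_trans FD.
apply: (@le_trans _ _ (\int[lebesgue_measure]_(x in `[a, b]) F x)%E); last first.
  by apply: ge0_subset_integral.
apply: (@le_trans _ _ (\int[lebesgue_measure]_(x in `[a, b]) (cst ((D + 1) / (b - a))%:E x))%E).
  rewrite integral_cst//; apply: (@le_trans _ _ (((D + 1) / (b - a))%:E * (b - a)%:E)%E).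
    by rewrite -EFinM divfK// gt_eqF.
  by rewrite le_eqVlt; apply/orP; left; apply/eqP; congr (_ * _)%E; exact: esym mab.
apply: ge0_le_integral => //.
- by move=> x _; rewrite lee_fin divr_ge0//; lra.
- exact: measurable_funTS.
Qed.

End Energy.

(** * Oscillation, growth, and orders of zeros *)

Section Growth.
Context {R : realType}.
Local Notation C := R[i].
Implicit Types (f : C -> C) (a z : C) (x y : R).
Local Opaque complex_derive.

Lemma rectangle_compact (x1 x2 y1 y2 : R) :
  compact ([set z | x1 <= complex.Re z <= x2 /\ y1 <= complex.Im z <= y2] : set C^o).
Proof.
have -> : [set z : C^o | x1 <= complex.Re z <= x2 /\ y1 <= complex.Im z <= y2] =
    (fun p : R * R => (p.1 +i* p.2)%C : C^o) @`
      (`[x1, x2]%classic `*` `[y1, y2]%classic).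
  apply/seteqP; split => [[x y] /= [hx hy]|z [[x y] [/=]]].
    by exists (x, y) => //; rewrite /= !in_itv.
  by rewrite !in_itv/= => hx hy <-.
apply: (@continuous_compact (R * R)%type C^o); last first.
  by apply: compact_setX; exact: segment_compact.
apply: continuous_subspaceT => -[x y] V /= /nbhs_normcP[d d0 HV].
by have := nbhs_plane x y d0; apply: filterS => p; exact: HV.
Qed.

Lemma closed_disc_compact (r : R) : compact ([set z | normc z <= r] : set C^o).
Proof.
apply: (@subclosed_compact C^o _ _ _ (@rectangle_compact (- r) r (- r) r)).
  rewrite -openC openE => z /= /negP; rewrite -ltNge => zr.
  apply/nbhs_normcP; exists (normc z - r); first by rewrite subr_gt0.
  move=> w wz; apply/negP; rewrite -ltNge.
  have := distcD w z 0; rewrite !subr0 (distcC z); lra.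
move=> z /= zr; rewrite -!ler_norml; split.
  exact: le_trans (normRe z) zr.
exact: le_trans (normIm z) zr.
Qed.

(** The modulus is at most the sum of the two coordinate offsets, which is the origin of the margin
    [4 * h] in the growth estimates. *)
Lemma square_in_disc a (h x y : R) : normc a + 4 * h < 1 ->
  `|x - complex.Re a| <= 2 * h -> `|y - complex.Im a| <= 2 * h ->
  unit_disc (x +i* y)%C.
Proof.
case: a => x0 y0 a1 hx hy; apply/unit_discE.
have := distcD (x0 +i* y0)%C (x +i* y)%C 0; rewrite !subr0.
have := normc_le_ReIm ((x +i* y)%C - (x0 +i* y0)%C).
rewrite [complex.Re _]/= [complex.Im _]/=; rewrite /= in hx hy.
move: a1; set q := normc (x0 +i* y0)%C; lra.
Qed.

Section Oscillation.
Variables (f : C -> C) (D : R).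
Hypotheses (hf : holomorphic f) (D0 : 0 <= D).
Hypothesis energy :
  (\int[(lebesgue_measure \x lebesgue_measure)%E]_p plane_energy f p <= D%:E)%E.

Lemma good_vertical (a b : R) : a < b -> exists2 x, a <= x <= b &
  (\int[lebesgue_measure]_y plane_energy f (x, y) <= ((D + 1) / (b - a))%:E)%E.
Proof.
move=> ab; have mE := measurable_plane_energy hf.
apply: (@good_value _ (fun x => \int[lebesgue_measure]_y plane_energy f (x, y))%E) => //.
- by apply: measurable_fun_fubini_tonelli_F => // p; exact: plane_energy_ge0.
- by move=> x; apply: integral_ge0 => y _; exact: plane_energy_ge0.
- have := @fubini_tonelli1 _ _ _ _ _ lebesgue_measure lebesgue_measure _ mE (plane_energy_ge0 f).
  by move: energy => /[swap] ->.
Qed.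

Lemma good_horizontal (a b : R) : a < b -> exists2 y, a <= y <= b &
  (\int[lebesgue_measure]_x plane_energy f (x, y) <= ((D + 1) / (b - a))%:E)%E.
Proof.
move=> ab; have mE := measurable_plane_energy hf.
apply: (@good_value _ (fun y => \int[lebesgue_measure]_x plane_energy f (x, y))%E) => //.
- by apply: measurable_fun_fubini_tonelli_G => // p; exact: plane_energy_ge0.
- by move=> y; apply: integral_ge0 => x _; exact: plane_energy_ge0.
- have := @fubini_tonelli2 _ _ _ _ _ lebesgue_measure lebesgue_measure _ mE (plane_energy_ge0 f).
  by move: energy => /[swap] ->.
Qed.

(** [l] gives in real coordinates the line that [p + q * t] gives in the complex plane, so that one
    argument serves vertical lines (q = i) and horizontal ones (q = 1). *)
Lemma line_bound (p q : C) (l : R -> R * R) (a b K : R) : normc q = 1 ->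
  measurable_fun setT l ->
  (forall t, ((l t).1 +i* (l t).2)%C = p + q * t%:C%C) -> a <= b -> 0 <= K ->
  (forall t, a <= t <= b -> unit_disc (p + q * t%:C%C)) ->
  (\int[lebesgue_measure]_t plane_energy f (l t) <= K%:E)%E ->
  normc (f (p + q * b%:C%C) - f (p + q * a%:C%C)) <= 2 * (b - a + K).
Proof.
move=> q1 ml lE; rewrite le_eqVlt => /predU1P[<- K0 _ _|ab K0 disc IK].
  by rewrite !subrr normc0 add0r mulr_ge0.
apply: segment_bound => //; apply: le_trans IK.
apply: (@le_trans _ _ (\int[lebesgue_measure]_(t in `[a, b]) plane_energy f (l t))%E).
  rewrite le_eqVlt; apply/orP; left; apply/eqP; apply: eq_integral => t.
  rewrite inE/= in_itv/= => tab; have := lE t; case: (l t) => x y /= xy.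
  by rewrite plane_energyE xy//; exact: disc.
apply: ge0_subset_integral => //.
- apply: (measurableT_comp (measurable_plane_energy hf)); exact: ml.
- by move=> t _; exact: plane_energy_ge0.
Qed.

Lemma vertical_bound (x y1 y2 K : R) : y1 <= y2 -> 0 <= K ->
  (forall y, y1 <= y <= y2 -> unit_disc (x +i* y)%C) ->
  (\int[lebesgue_measure]_y plane_energy f (x, y) <= K%:E)%E ->
  normc (f (x +i* y2)%C - f (x +i* y1)%C) <= 2 * (y2 - y1 + K).
Proof.
move=> y12 K0 disc IK.
have E y : (x +i* y)%C = x%:C%C + 'i%C * y%:C%C by simpc.
rewrite !E; apply: (@line_bound _ _ (fun y => (x, y))) => //.
- by rewrite /= expr0n add0r expr1n sqrtr1.
- exact: pair1_measurable.
- by move=> t /disc; rewrite E.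
Qed.

Lemma horizontal_bound (y x1 x2 K : R) : x1 <= x2 -> 0 <= K ->
  (forall x, x1 <= x <= x2 -> unit_disc (x +i* y)%C) ->
  (\int[lebesgue_measure]_x plane_energy f (x, y) <= K%:E)%E ->
  normc (f (x2 +i* y)%C - f (x1 +i* y)%C) <= 2 * (x2 - x1 + K).
Proof.
move=> x12 K0 disc IK.
have E x : (x +i* y)%C = (0 +i* y)%C + 1 * x%:C%C by rewrite mul1r; simpc.
rewrite (E x2) (E x1); apply: (@line_bound _ _ (fun x => (x, y))) => //.
- by rewrite normc1.
- by move=> t /disc; rewrite E.
Qed.

(* Tonelli provides, on each side of [a], a line of energy at most [(D + 1) / h];
   [f] varies little along the rectangle these four lines bound. *)
Lemma oscillation a (h : R) : 0 < h -> normc a + 4 * h < 1 ->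
  forall b, normc (b - a) <= h ->
  normc (f b - f a) <= 8 * (4 * h + (D + 1) / h).
Proof.
case: a => x0 y0 h0 a1 b ba; have sq := square_in_disc a1.
rewrite [complex.Re _]/= [complex.Im _]/= in sq.
set a := (x0 +i* y0)%C in a1 ba *.
set K := (D + 1) / h; have K0 : 0 <= K by rewrite divr_ge0 ?addr_ge0// ltW.
(* Each line is sought at distance between [h] and [2 * h] from [a]: the rectangle then contains the
   disc of radius [h] and lies in the square of [square_in_disc]. *)
have lt1 x : x - 2 * h < x - h by lra.
have lt2 x : x + h < x + 2 * h by lra.
have [x1 hx1 Ex1] := good_vertical (lt1 x0).
have [x2 hx2 Ex2] := good_vertical (lt2 x0).
have [y1 hy1 Ey1] := good_horizontal (lt1 y0).
have [y2 hy2 Ey2] := good_horizontal (lt2 y0).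
rewrite (_ : _ - _ - _ = h) -/K in Ex1; last by ring.
rewrite (_ : _ - _ - _ = h) -/K in Ey1; last by ring.
rewrite (_ : x0 + 2 * h - _ = h) -/K in Ex2; last by ring.
rewrite (_ : y0 + 2 * h - _ = h) -/K in Ey2; last by ring.
pose Q := [set z : C | x1 <= complex.Re z <= x2 /\ y1 <= complex.Im z <= y2].
pose B := [set z : C | [\/ complex.Re z = x1, complex.Re z = x2,
                         complex.Im z = y1 | complex.Im z = y2]].
pose c := (x1 +i* y1)%C.
have Qd z : Q z -> unit_disc z.
  by case: z => x y [/= hx hy]; apply: sq; rewrite ler_norml; apply/andP; split; lra.
have Qd2 x y : x1 <= x <= x2 -> y1 <= y <= y2 -> unit_disc (x +i* y)%C.
  by move=> *; apply: Qd.
(* A side has length at most [4 * h], and each boundary point is reached from the corner [c] along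
   at most two sides. *)
pose L := 2 * (4 * h + K).
have bdB z : Q z -> B z -> normc (f z - f c) <= 2 * L.
  case: z => x y [/= hx hy] Bz.
  have left_side : normc (f (x1 +i* y)%C - f c) <= L.
    apply: (le_trans (vertical_bound _ K0 _ Ex1)); try lra.
      by move=> t ht; apply: Qd2; lra.
    by rewrite /L; lra.
  have bottom : normc (f (x +i* y1)%C - f c) <= L.
    apply: (le_trans (horizontal_bound _ K0 _ Ey1)); try lra.
      by move=> t ht; apply: Qd2; lra.
    by rewrite /L; lra.
  have L0 : 0 <= L by rewrite /L; lra.
  case: Bz => /= E; subst.
  - by rewrite -/c; lra.
  - apply: le_trans (distcD (f (x2 +i* y1)%C) _ _) _.
    have : normc (f (x2 +i* y)%C - f (x2 +i* y1)%C) <= L.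
      apply: (le_trans (vertical_bound _ K0 _ Ex2)); try lra.
        by move=> t ht; apply: Qd2; lra.
      by rewrite /L; lra.
    by lra.
  - by lra.
  - apply: le_trans (distcD (f (x1 +i* y2)%C) _ _) _.
    have : normc (f (x +i* y2)%C - f (x1 +i* y2)%C) <= L.
      apply: (le_trans (horizontal_bound _ K0 _ Ey2)); try lra.
        by move=> t ht; apply: Qd2; lra.
      by rewrite /L; lra.
    by lra.
have bound z : Q z -> normc (f z - f c) <= 2 * L.
  apply: (@max_principle R Q B (fun z => f z - f c)) => //.
  - exact: rectangle_compact.
  - by move=> w /Qd/unit_discE/ltW.
  - by move=> w /Qd/hf/analytic_jet; exact: has_jetB.
  - move=> [x y] [/= hx hy] nB.
    have x1x : x1 < x by rewrite lt_neqAle; move: hx => /andP[-> _]; rewrite andbT;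
      apply/eqP => E; apply: nB; constructor 1.
    have xx2 : x < x2 by rewrite lt_neqAle; move: hx => /andP[_ ->]; rewrite andbT;
      apply/eqP => E; apply: nB; constructor 2.
    have y1y : y1 < y by rewrite lt_neqAle; move: hy => /andP[-> _]; rewrite andbT;
      apply/eqP => E; apply: nB; constructor 3.
    have yy2 : y < y2 by rewrite lt_neqAle; move: hy => /andP[_ ->]; rewrite andbT;
      apply/eqP => E; apply: nB; constructor 4.
    exists (Num.min (Num.min (x - x1) (x2 - x)) (Num.min (y - y1) (y2 - y))).
      by rewrite !lt_min !subr_gt0 x1x xx2 y1y yy2.
    move=> [u v]; rewrite !lt_min => /andP[/andP[u1 u2] /andP[v1 v2]].
    have := normRe (u +i* v)%C; have := normIm (u +i* v)%C => /= hv hu.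
    move: hu hv; rewrite !ler_norml => /andP[? ?] /andP[? ?].
    by split => /=; apply/andP; split; rewrite /= in u1 u2 v1 v2 *; lra.
have Qb z : normc (z - a) <= h -> Q z.
  case: z => x y za; have := normRe ((x +i* y)%C - a); have := normIm ((x +i* y)%C - a).
  rewrite [complex.Re _]/= [complex.Im _]/=.
  move: za; move: (normc _) => n nh; rewrite !ler_norml => /andP[? ?] /andP[? ?].
  by split => /=; apply/andP; split; lra.
have := bound b (Qb b ba); have := bound a (Qb a _).
rewrite subrr normc0 => /(_ (ltW h0)).
have := distcD (f c) (f b) (f a); rewrite (distcC (f c)) /L.
move: (normc (f b - f a)) (normc (f b - f c)) (normc (f a - f c)) => ? ? ?.
lra.
Qed.

(** A radial chain from 0 to [z] of n + 1 steps of length at most 1 / (n + 1), each costing O(n + 1)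
    by [oscillation]: hence the exponent 2 of the growth. *)
Lemma growth z (n : nat) : normc z + 4 * n.+1%:R^-1 < 1 ->
  normc (f z) <= normc (f 0) +
    n.+1%:R * (8 * (4 * n.+1%:R^-1 + (D + 1) / n.+1%:R^-1)).
Proof.
set h : R := n.+1%:R^-1 => zh.
have h0 : 0 < h by rewrite invr_gt0 ltr0n.
pose w j := z * (j%:R * h)%:C%C.
have nw j : normc (w j) = normc z * (j%:R * h).
  by rewrite normcM normc_real ger0_norm// mulr_ge0// ltW.
have z1 : normc z <= 1 by lra.
have step j : (j <= n.+1)%N ->
    normc (f (w j) - f 0) <= j%:R * (8 * (4 * h + (D + 1) / h)).
  elim: j => [|j IH] jn; first by rewrite /w !mul0r mulr0 subrr normc0.
  apply: le_trans (distcD (f (w j)) _ _) _.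
  rewrite -natr1 mulrDl mul1r addrC lerD ?IH 1?ltnW//.
  apply: oscillation => //.
    have : normc (w j) <= normc z; last by lra.
    rewrite nw ler_piMr ?normc_ge0// /h ler_pdivrMr ?ltr0n// mul1r ler_nat.
    exact: ltnW.
  rewrite (_ : w j.+1 - w j = z * h%:C%C); last first.
    by rewrite /w -natr1 mulrDl mul1r rmorphD /= mulrDr addrAC subrr add0r.
  by rewrite normcM normc_real gtr0_norm// ler_piMl// ltW.
have wn : w n.+1 = z.
  by rewrite /w /h divff ?pnatr_eq0// mulr1.
have := step _ (leqnn _); rewrite wn.
by have := distcD (f 0) (f z) 0; rewrite !subr0; lra.
Qed.

End Oscillation.

(* Maximum principle for [f w * ((r ^+ 2 - p w) / (w - p)) ^+ m], whose second
   factor has modulus [r ^+ m] on the circle of radius [r]. *)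
Lemma zero_order_bound f (p r M : R) m : holomorphic f -> 0 < p -> p < r -> r < 1 ->
  has_zero_of_order f p%:C%C m ->
  (forall z, normc z = r -> normc (f z) <= M) ->
  normc (f 0) * (r / p) ^+ m <= M.
Proof.
move=> hf p0 pr r1 [g [ag _ /nbhs_normcP[d d0 fg]]] fM.
have r0 : 0 < r by lra.
set P : C := p%:C%C in ag fg.
pose N (w : C) := (r ^+ 2)%:C%C - P * w.
(* The factorization of [f] near [P] makes the singularity removable, and [g] supplies the missing
   value. *)
pose G w := if w == P then g P * N P ^+ m else f w * (N w ^+ m * (w - P)^-1 ^+ m).
have jN w : has_jet N w.
  apply: (has_jet_near ltr01 _ (has_jet_poly ((r ^+ 2)%:C%C%:P - P%:P * 'X) w)) => h _.
  by rewrite /N !hornerE.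
have jG w : normc w <= r -> has_jet G w.
  move=> wr; have [->|wP] := eqVneq w P.
    have jg := has_jetM (analytic_jet ag) (has_jetX m (jN P)).
    apply: (has_jet_near d0 _ jg) => h hd; rewrite /G.
    case: eqP => [->//|/eqP hP].
    have hP0 : P + h - P != 0 by rewrite subr_eq0.
    rewrite fg; last by rewrite addrAC subrr add0r.
    rewrite exprVn; move: (expf_neq0 m hP0).
    move: (g _) (N _ ^+ m) ((P + h - P) ^+ m) => u v t t0.
    by rewrite [v / t]mulrC [t * u]mulrC -mulrA mulVKf.
  have w1 : unit_disc w by apply/unit_discE; exact: le_lt_trans r1.
  have jf := has_jetM (analytic_jet (hf _ w1))
     (has_jetM (has_jetX m (jN w)) (has_jetX m (has_jet_inv wP))).
  have nwP : 0 < normc (w - P) by rewrite normc_gt0 subr_eq0.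
  apply: (has_jet_near nwP _ jf) => h hd; rewrite /G.
  case: eqP => // E; move: hd; rewrite -E opprD addrA subrr sub0r normcN ltxx //.
have mp : forall z, normc z <= r -> normc (G z) <= M * r ^+ m.
  apply: (@max_principle R [set z | normc z <= r] [set z | normc z = r]).
  - exact: closed_disc_compact.
  - by move=> z /= zr; lra.
  - by move=> z; exact: jG.
  - move=> z /= zr nz; exists (r - normc z).
      by rewrite subr_gt0 lt_neqAle zr andbT; apply/eqP.
    by move=> h hd; apply: le_trans (normcD _ _) _; lra.
  move=> z /= _ zr; rewrite /G.
  case: eqP => [E|/eqP zP].
    by move: zr; rewrite E normc_real gtr0_norm//; lra.
  have nz : normc (N z) = r * normc (z - P).
    have n0 := normc_ge0 (N z); have n1 := normc_ge0 (z - P).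
    apply/eqP; rewrite -(@eqrXn2 _ 2)// ?mulr_ge0 ?(ltW r0)//.
    have : normc z ^+ 2 = r ^+ 2 by rewrite zr.
    rewrite /N /P exprMn; case: (z) => x y; rewrite normcC => xy.
    simpc; rewrite ?mul0r ?subr0 ?addr0 ?oppr0 !normcC -xy; apply/eqP; ring.
  have nzP : 0 < normc (z - P) by rewrite normc_gt0 subr_eq0.
  rewrite normcM -exprMn normcX (normcM (N z)) normcV nz mulfK ?gt_eqF//.
  by rewrite ler_wpM2r ?exprn_ge0 ?fM// ltW.
have := mp 0; rewrite normc0 => /(_ (ltW r0)).
rewrite /G; case: eqP => [E|_].
  have : normc P = 0 by rewrite -E normc0.
  by rewrite normc_real gtr0_norm//; lra.
(* At 0 the factor has modulus (r^2 / p)^m, and one power r^m cancels against the bound on the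
   circle. *)
rewrite /N mulr0 subr0 sub0r -exprMn normcM normcX (normcM (r ^+ 2)%:C%C).
rewrite normcV normcN !normc_real !gtr0_norm ?exprn_gt0//.
rewrite (_ : r ^+ 2 / p = (r / p) * r); last by ring.
by rewrite exprMn mulrA ler_pM2r// exprn_gt0.
Qed.

End Growth.

(** * Measure of arcs *)

Section Arcs.
Context {R : realType}.
Local Notation C := R[i].
Local Notation mu := (@lebesgue_measure R).
Implicit Types (zeta : C) (t s rho : R) (m : nat).

Lemma sin_lower_bound (u : R) : `|u| <= 1 -> cos 1 * `|u| <= `|sin u|.
Proof.
wlog u0 : u / 0 <= u.
  move=> H; have [/H//|/ltW u0] := leP 0 u.
  by have := H (- u); rewrite oppr_ge0 sinN !normrN; apply.
rewrite ger0_norm// => u1.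
have [c] := @MVT_segment R sin cos 0 u u0 (fun x _ => is_derive_sin x)
  (continuous_subspaceT (@continuous_sin R)).
rewrite in_itv/= sin0 !subr0 => /andP[c0 cu] ->.
apply: le_trans (ler_norm _); rewrite ler_wpM2r//.
have := @pi_ge2 R => pi2.
rewrite leNgt ltr_cos ?in_itv/=; last 2 first.
- by apply/andP; split; lra.
- by apply/andP; split; lra.
by rewrite -leNgt; lra.
Qed.

Definition circle_point t : C := (cos t +i* sin t)%C.

(** After rotation by e^(-is) the chord has imaginary part sin (t - s), to which [sin_lower_bound]
    applies. *)
Lemma circle_point_dist t s : `|t - s| <= 1 ->
  cos 1 * `|t - s| <= normc (circle_point t - circle_point s).
Proof.
move=> /sin_lower_bound H; apply: le_trans H _.
rewrite -(@ler_sqr _ _ _ _)?nnegrE ?normc_ge0// real_normK ?num_real//.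
rewrite /circle_point (_ : _ - _ = ((cos t - cos s) +i* (sin t - sin s))%C)//.
rewrite normcC sinB.
have := cos2Dsin2 s; move: (cos s) (sin s) (cos t) (sin t) => a b c d ab.
have -> : (c - a) ^+ 2 + (d - b) ^+ 2 = ((c - a) ^+ 2 + (d - b) ^+ 2) * (a ^+ 2 + b ^+ 2).
  by rewrite ab mulr1.
have -> : d * a - c * b = (d - b) * a - (c - a) * b by ring.
have := sqr_ge0 ((c - a) * a + (d - b) * b); nra.
Qed.

Definition arc zeta rho : set R :=
  `[0, 2 * pi] `&` [set t | normc (circle_point t - zeta) <= rho].

Lemma measurable_arc zeta rho : 0 <= rho -> measurable (arc zeta rho).
Proof.
move=> rho0; apply: measurableI; first exact: measurable_itv.
case: zeta => a b.
pose u t := (cos t - a) * (cos t - a) + (sin t - b) * (sin t - b).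
have -> : [set t | normc (circle_point t - (a +i* b)%C) <= rho] =
    setT `&` u @^-1` `]-oo, rho ^+ 2]%classic.
  have uE t : u t = normc (circle_point t - (a +i* b)%C) ^+ 2.
    by rewrite (_ : _ - _ = ((cos t - a) +i* (sin t - b))%C)// normcC !expr2.
  rewrite setTI; apply/seteqP; split => t; rewrite /preimage/= in_itv/= uE;
  by rewrite ler_sqr ?nnegrE ?normc_ge0.
suff mu_ : measurable_fun setT u by apply: mu_ => //; exact: measurable_itv.
have mc : measurable_fun setT (fun t : R => cos t - a).
  by apply: measurable_funB => //; exact: continuous_measurable_fun (@continuous_cos R).
have ms : measurable_fun setT (fun t : R => sin t - b).
  by apply: measurable_funB => //; exact: continuous_measurable_fun (@continuous_sin R).
by apply: measurable_funD; apply: measurable_funM.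
Qed.

Definition arc_const : R := 32 / cos 1.

Lemma arc_const_gt0 : 0 < arc_const.
Proof. by rewrite divr_gt0// cos1_gt0. Qed.

(* On each [i, i + 1] two points of the arc are at distance at most
   [2 * rho / cos 1], by [circle_point_dist]; eight such intervals cover [0, 2 pi]. *)
Lemma arc_measure zeta rho : 0 <= rho ->
  (mu (arc zeta rho) <= (arc_const * rho)%:E)%E.
Proof.
move=> rho0; pose c : R := cos 1; have c0 : 0 < c := cos1_gt0 R.
pose J (i : nat) := arc zeta rho `&` `[(i%:R : R), i%:R + 1].
have mJ i : measurable (J i).
  by apply: measurableI; [exact: measurable_arc|exact: measurable_itv].
have J4 i : (mu (J i) <= (4 * rho / c)%:E)%E.
  have [->|/set0P[t0 [[_ /= t0r] t0i]]] := eqVneq (J i) set0.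
    by rewrite measure0 lee_fin divr_ge0 ?mulr_ge0// ltW.
  pose e := 2 * rho / c; have e0 : 0 <= e by rewrite divr_ge0 ?mulr_ge0// ltW.
  pose I : set R := `[t0 - e, t0 + e]%classic.
  have JI : J i `<=` I.
    move=> t [[_ /= tr] ti]; rewrite /I /= !in_itv/= in t0i ti *.
    have tt0 : `|t - t0| <= 1 by rewrite ler_norml; apply/andP; split; lra.
    have := circle_point_dist tt0 => H.
    have := distcD zeta (circle_point t) (circle_point t0); rewrite (distcC zeta) => H2.
    have : `|t - t0| <= e.
      by rewrite /e ler_pdivlMr// mulrC; apply: le_trans H _; lra.
    by rewrite ler_norml => /andP[? ?]; apply/andP; split; lra.
  have mI : measurable I by exact: measurable_itv.
  apply: (le_trans (le_measure mu (mem_set (mJ i)) (mem_set mI) JI)).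
  have : (mu I <= (4 * rho / c)%:E)%E; last exact.
  rewrite /I lebesgue_measure_itv/= lte_fin; case: ifP => _.
    by rewrite -EFinB lee_fin /e [leRHS](_ : _ = 2 * rho / c + 2 * rho / c); [lra|ring].
  by rewrite lee_fin divr_ge0 ?mulr_ge0// ltW.
have cover : arc zeta rho `<=` \big[setU/set0]_(i < 8) J i.
  move=> t [t2pi tr]; rewrite -bigcup_mkord.
  have /andP[t0 t2] : 0 <= t <= 2 * pi by move: t2pi; rewrite /= in_itv.
  (* Since 2 pi < 8, the integer part of [t] is one of the eight indices. *)
  exists (Num.truncn t).
    rewrite /= -(ltr_nat R); have := truncn_le t; rewrite t0 => H.
    by have := @pihalf_lt2 R; lra.
  split=> //; rewrite /= in_itv/= truncn_le t0/= natr1.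
  exact/ltW/truncnS_gt.
apply: (le_trans (@content_subadditive _ _ _ mu _ J 8 (fun k _ => mJ k) (measurable_arc _ rho0) cover)).
apply: (@le_trans _ _ (\sum_(k < 8) (4 * rho / c)%:E)%E).
  by apply: lee_sum => i _; exact: J4.
rewrite sumEFin lee_fin sumr_const card_ord /arc_const -/c.
by rewrite -mulr_natl le_eqVlt; apply/orP; left; apply/eqP; ring.
Qed.

(* For [m = 0] and [|e^it - zeta| <= 1] this is [log2 (1 / |e^it - zeta|)] up to an
   error of at most 1, and [+oo] at [zeta]; the first [m] scales are not counted. *)
Definition arc_count zeta m t : \bar R :=
  (\sum_(j <oo) (\1_(arc zeta (2^-1 ^+ (j + m))) t)%:E)%E.

Lemma nneseries_le (u : nat -> \bar R) (M : \bar R) : (forall n, 0 <= u n)%E ->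
  (forall n, \sum_(i < n) u i <= M)%E -> (\sum_(i <oo) u i <= M)%E.
Proof.
move=> u0 uM; apply: lime_le; first exact: is_cvg_nneseries.
by apply: nearW => n; rewrite big_mkord.
Qed.

Lemma sum_half_lt2 n : \sum_(j < n) (2^-1 : R) ^+ j <= 2.
Proof. by apply: geom_half_sum; lra. Qed.

Lemma arc_count_ge0 zeta m t : (0 <= arc_count zeta m t)%E.
Proof. by apply: nneseries_ge0 => j _ _; rewrite lee_fin. Qed.

Lemma half_exp_ge0 k : 0 <= (2^-1 : R) ^+ k.
Proof. by rewrite exprn_ge0// invr_ge0. Qed.

Lemma measurable_arc_indic zeta rho : 0 <= rho ->
  measurable_fun setT (fun t => (\1_(arc zeta rho) t : R)%:E).
Proof.
by move=> r0; apply/measurable_EFinP/measurable_indic; exact: measurable_arc.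
Qed.

Lemma measurable_arc_count zeta m : measurable_fun setT (arc_count zeta m).
Proof.
apply: ge0_emeasurable_sum => [j t _ _|j _]; first by rewrite lee_fin.
by apply: measurable_arc_indic; exact: half_exp_ge0.
Qed.

(** The arcs of radius 2^-(j + m) have measures bounded by a geometric series in [j]. Skipping [m]
    scales gains the factor 2^-m that later makes the sum over all points finite. *)
Lemma integral_arc_count zeta m :
  (\int[mu]_(t in `[0%R, (2 * pi)%R]) arc_count zeta m t <=
     (arc_const * 2 * 2^-1 ^+ m)%:E)%E.
Proof.
have mI : measurable (`[0, 2 * pi]%classic : set R) by exact: measurable_itv.
rewrite integral_nneseries//; last first.
  by move=> j; apply: measurable_funTS; apply: measurable_arc_indic; exact: half_exp_ge0.
apply: nneseries_le => [j|n]; first by apply: integral_ge0 => t _; rewrite lee_fin.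
apply: (@le_trans _ _ (\sum_(j < n) (arc_const * 2^-1 ^+ (j + m))%:E)%E).
  apply: lee_sum => j _; rewrite integral_indic//; last by apply: measurable_arc; exact: half_exp_ge0.
  rewrite setIidl; last by move=> t [].
  by apply: arc_measure; exact: half_exp_ge0.
rewrite sumEFin lee_fin -mulr_sumr -mulrA ler_wpM2l ?(ltW arc_const_gt0)//.
under eq_bigr do rewrite exprD.
by rewrite -mulr_suml ler_wpM2r ?half_exp_ge0// sum_half_lt2.
Qed.

(** If [t] lay in all the arcs with index up to the integer part of [s], the count would exceed [s];
    so one of them misses [t]. *)
Lemma arc_count_lower zeta m t (s : R) : 0 <= t <= 2 * pi ->
  (arc_count zeta m t <= s%:E)%E ->
  exists2 j : nat, j%:R <= s & 2^-1 ^+ (j + m) < normc (circle_point t - zeta).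
Proof.
move=> t2pi cs; apply: contrapT => nj.
have s0 : 0 <= s by rewrite -lee_fin (le_trans _ cs)// arc_count_ge0.
suff : ((Num.truncn s).+1%:R%:E <= s%:E)%E.
  by rewrite lee_fin leNgt truncnS_gt.
apply: le_trans cs; rewrite /arc_count.
have u0 (j : nat) : (0 <= j)%N -> true -> (0 <= (\1_(arc zeta (2^-1 ^+ (j + m))) t : R)%:E)%E.
  by move=> _ _; rewrite lee_fin.
apply: le_trans (nneseries_lim_ge (Num.truncn s).+1 u0).
rewrite big_mkord (eq_bigr (fun=> 1%:E)); last first.
  move=> j _; rewrite indicE mem_set//; split; first by rewrite /= in_itv.
  rewrite /= leNgt; apply/negP => lt; apply: nj; exists j => //.
  by rewrite (le_trans _ (_ : (Num.truncn s)%:R <= s))// ?truncn_le// ler_nat -ltnS.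
by rewrite sumEFin sumr_const card_ord.
Qed.

End Arcs.

(** * Counting zeros and integrating the distance *)

Section Counting.
Context {R : realType}.
Local Notation C := R[i].
Local Opaque complex_derive.

(** Passes from a whole fibre of the sequence, whose cardinality is the order of a zero, to the
    initial segments over which finite sums run. *)
Lemma count_card_le (A : set nat) (P : pred nat) (m N : nat) :
  (A #= `I_m)%card -> (forall n, P n -> A n) -> (count P (iota 0 N) <= m)%N.
Proof.
move=> Am PA; rewrite -size_filter; set s := [seq n <- iota 0 N | P n].
have us : uniq s by rewrite filter_uniq// iota_uniq.
rewrite -card_le_II.
have inj : {in `I_(size s) &, injective (nth 0%N s)}.
  move=> i j; rewrite !inE /= => si sj /eqP.
  by rewrite nth_uniq// => /eqP.
have /card_eqPle[_ s1] := inj_card_eq inj.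
have /card_eqPle[s3 _] := Am.
apply: card_le_trans s1 _; apply: card_le_trans s3.
apply: subset_card_le => _ [j /= js <-]; apply: PA.
by have := mem_nth 0%N js; rewrite mem_filter => /andP[].
Qed.

Lemma dyadic_zeros_bound (w : nat -> C) (k : nat -> nat) :
  (forall n, w n = (1 - 2^-1 ^+ (k n).+1)%:C%C) -> zero_sequence w ->
  exists2 M : R, 0 <= M & forall kappa N,
    (count (fun n => k n == kappa) (iota 0 N))%:R <= M * 8 ^+ kappa.
Proof.
move=> wE [wd fin [f Df [ford fnz]]].
have [hf [D D0 energy]] := dirichlet_energy Df.
have half1 n : 0 < (2^-1 : R) ^+ n.+1 <= 2^-1.
  have h0 : (0 : R) <= 2^-1 by lra.
  have h1 : (2^-1 : R) <= 1 by lra.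
  by rewrite exprn_gt0 ?invr_gt0//= exprS ler_piMr// exprn_ile1.
(* The exponent [(k n).+1], rather than [k n], keeps every [w n] at least 1/2, so 0 is not among the
   zeros. *)
have f00 : f 0 != 0.
  apply: fnz; first by apply/unit_discE; rewrite normc0.
  move=> [n _]; rewrite wE => -[] /eqP; rewrite subr_eq0 => /eqP E.
  by have := half1 (k n); rewrite -E => /andP[_]; lra.
pose F0 := normc (f 0); have F00 : 0 < F0 by rewrite normc_gt0.
(* Dominates [F0 + 32 + 256 * 32 * (D + 1)], the sum of the constants that [growth] produces
   below. *)
pose M1 := F0 + 256 * (36 + 32 * D); have M10 : 0 < M1 by rewrite /M1; lra.
exists (4 * M1 / F0); first by rewrite divr_ge0 ?mulr_ge0// ltW.
move=> kappa N; set c := count _ _.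
have Mk0 : 0 <= 4 * M1 / F0 * 8 ^+ kappa.
  by rewrite mulr_ge0 ?exprn_ge0// divr_ge0 ?mulr_ge0// ltW.
have [/hasP[n0 _ /eqP kn0]|] := boolP (has (fun n => k n == kappa) (iota 0 N)); last first.
  by rewrite has_count -/c -eqn0Ngt => /eqP ->.
have /finite_setP[m Am] := fin (w n0).
have cm : (c <= m)%N.
  by apply: count_card_le Am _ => n /eqP kn /=; rewrite !wE kn kn0.
have := ford (w n0) m (ex_intro2 _ _ n0 I erefl) Am; rewrite wE kn0.
set e : R := 2^-1 ^+ kappa; have e0 : 0 < e by rewrite exprn_gt0// invr_gt0.
have e1 : e <= 1 by apply: exprn_ile1; lra.
rewrite exprS -/e => zo.
(* Half-way between the zero at 1 - e / 2 and the unit circle. *)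
pose r := 1 - e / 4.
have p0 : 0 < 1 - 2^-1 * e by lra.
have pr : 1 - 2^-1 * e < r by rewrite /r; lra.
have r1 : r < 1 by rewrite /r; lra.
(* Then n + 1 = 32 / e, and the margin 4 / (n + 1) = e / 8 required by [growth] is smaller than 1 -
   r = e / 4. *)
pose n := (32 * 2 ^ kappa).-1.
have nS : n.+1 = (32 * 2 ^ kappa)%N by rewrite prednK// muln_gt0 expn_gt0.
have eV : e^-1 = 2 ^+ kappa by rewrite /e exprVn invrK.
have nE : n.+1%:R = 32 * e^-1 :> R by rewrite nS natrM natrX eV.
have fM z : normc z = r -> normc (f z) <= M1 * 4 ^+ kappa.
  move=> zr.
  have small : normc z + 4 * n.+1%:R^-1 < 1.
    by rewrite zr nE invfM invrK /r; lra.
  apply: le_trans (growth hf D0 energy small) _.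
  have hE : n.+1%:R^-1 = 32^-1 * e by rewrite nE invfM invrK.
  rewrite -/F0 hE nE.
  have -> : (4 : R) ^+ kappa = e^-1 * e^-1.
    by rewrite eV -exprMn; congr (_ ^+ _); lra.
  have E1 : 1 <= e^-1 by rewrite invf_ge1.
  have -> : 32 * e^-1 * (8 * (4 * (32^-1 * e) + (D + 1) / (32^-1 * e))) =
     32 * (e^-1 * e) + 256 * 32 * (D + 1) * (e^-1 * e^-1) by field; rewrite gt_eqF.
  have EE : 1 <= e^-1 * e^-1 by rewrite -[leLHS]mulr1 ler_pM.
  rewrite mulVf ?gt_eqF// /M1; move: (e^-1 * e^-1) EE => E2 E21.
  have : 0 <= F0 * (E2 - 1) by rewrite mulr_ge0 ?subr_ge0// ltW.
  clear -E21; lra.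
have := zero_order_bound hf p0 pr r1 zo fM; rewrite -/F0.
have rp : 1 + e / 4 <= r / (1 - 2^-1 * e).
  rewrite ler_pdivlMr// /r; have := mulr_ge0 (ltW e0) (ltW e0); clear -e0; lra.
have e4 : 0 <= e / 4 by rewrite divr_ge0// ltW.
have e5 : 0 <= 1 + e / 4 by rewrite addr_ge0.
(* Bernoulli's inequality makes the bound linear in [m]; dividing by e = 2^-kappa then raises
   4^kappa to 8^kappa. *)
have bern : 1 + m%:R * (e / 4) <= (r / (1 - 2^-1 * e)) ^+ m.
  apply: (@le_trans _ _ ((1 + e / 4) ^+ m)).
    elim: (m) => [|j IH]; first by rewrite mul0r addr0 expr0.
    rewrite exprS -natr1; apply: le_trans (ler_wpM2l _ IH); last by rewrite addr_ge0.
    have := mulr_ge0 e4 (mulr_ge0 (ler0n R j) e4).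
    clear; lra.
  by rewrite lerXn2r ?nnegrE// (le_trans e5).
move=> H.
have m1 : F0 * (m%:R * (e / 4)) <= M1 * 4 ^+ kappa.
  apply: le_trans H; rewrite ler_pM2l//; lra.
apply: (@le_trans _ _ m%:R); first by rewrite ler_nat.
have -> : (8 : R) ^+ kappa = e^-1 * 4 ^+ kappa.
  by rewrite eV -exprMn; congr (_ ^+ _); lra.
rewrite (_ : 4 * M1 / F0 * (e^-1 * 4 ^+ kappa) = M1 * 4 ^+ kappa * 4 / (F0 * e)); last first.
  by field; rewrite !gt_eqF.
by rewrite ler_pdivlMr ?mulr_gt0//; lra.
Qed.

(** Grouping by the value kappa of [k]: at most M 8^kappa terms equal to 16^-kappa contribute at
    most M 2^-kappa. *)
Lemma dyadic_sum_bound (k : nat -> nat) (M : R) : 0 <= M ->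
  (forall kappa N, (count (fun n => k n == kappa) (iota 0 N))%:R <= M * 8 ^+ kappa) ->
  forall N, \sum_(n < N) (2^-1 : R) ^+ (4 * k n) <= M * 2.
Proof.
move=> M0 kM N; pose K := (\max_(n < N) k n).+1.
have kK (n : 'I_N) : (k n < K)%N by rewrite ltnS; exact: leq_bigmax.
have E (n : 'I_N) : (2^-1 : R) ^+ (4 * k n) =
    \sum_(kappa < K) (k n == kappa)%:R * 2^-1 ^+ (4 * kappa).
  rewrite (bigD1 (Ordinal (kK n)))//= eqxx mul1r big1 ?addr0// => i.
  rewrite eq_sym -val_eqE /= => /negbTE ->; exact: mul0r.
rewrite (eq_bigr _ (fun n _ => E n)) exchange_big /=.
apply: (@le_trans _ _ (\sum_(kappa < K) M * 2^-1 ^+ kappa)).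
  apply: ler_sum => kappa _; rewrite -mulr_suml.
  have -> : \sum_(i < N) ((k i == kappa)%:R : R) =
      (count (fun n => k n == kappa) (iota 0 N))%:R.
    have -> : iota 0 N = index_iota 0 N by rewrite /index_iota subn0.
    rewrite -sum1_count natr_sum [RHS]big_mkcond /= big_mkord.
    by apply: eq_bigr => i _; case: eqP.
  apply: le_trans (ler_wpM2r (half_exp_ge0 _) (kM kappa N)) _.
  rewrite -mulrA ler_wpM2l// exprM -exprMn.
  by rewrite (_ : 8 * _ = 2^-1)//; field.
by rewrite -mulr_sumr ler_wpM2l// sum_half_lt2.
Qed.

End Counting.

(** * Pointwise bounds on the logarithm of the distance *)

Section LogDistance.
Import HBNNSimple.
Context {R : realType}.
Local Notation C := R[i].

Lemma expR_opp_le_half (j : nat) (s : R) : j%:R <= s -> expR (- s) <= 2^-1 ^+ j.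
Proof.
move=> js; apply: (@le_trans _ _ (expR (- j%:R))); first by rewrite ler_expR lerN2.
rewrite expRN -[j%:R]mulr1 expRM_natl -exprVn lerXn2r ?nnegrE ?invr_ge0 ?expR_ge0//.
rewrite lef_pV2 ?posrE ?expR_gt0//; have := @expR_ge1Dx R 1; lra.
Qed.

(* Either [zeta] is at least half as far from [e^it] as [1] is, or [e^it] is within
   [8 / 2 ^ k] of [1], so that [k] is controlled by the first count. *)
Lemma normc_ge_exp (zeta : C) (k : nat) (t Y X : R) : 0 <= t <= 2 * pi ->
  0 <= Y -> 0 <= X -> normc (zeta - 1) <= 4 * 2^-1 ^+ k ->
  (arc_count (1%R : C) 0 t <= Y%:E)%E -> (arc_count zeta (4 * k)%N t <= X%:E)%E ->
  expR (- (8 + 4 * Y + X)) <= normc (circle_point t - zeta).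
Proof.
move=> t2 Y0 X0 zk cY cX.
have [j jY] := arc_count_lower t2 cY; rewrite addn0.
have [i iX] := arc_count_lower t2 cX.
set x := normc (circle_point t - zeta); set y := normc (circle_point t - 1).
move=> xi yj.
have xyz : y <= x + normc (zeta - 1) by exact: distcD.
have [yx|xy] := leP (y / 2) x.
  apply: (@le_trans _ _ (2^-1 ^+ j.+1)); last by rewrite exprS; lra.
  apply: expR_opp_le_half; rewrite -natr1; lra.
(* Here 2^-j < y, x < y / 2 and y <= x + 4 * 2^-k give 2^-j < 8 * 2^-k. So k <= j + 2 and i + 4 k <=
   X + 4 Y + 8, the origin of the constant 8. *)
have kj : (k < j + 3)%N.
  rewrite ltnNge; apply/negP => jk.
  have : (2^-1 : R) ^+ k <= 2^-1 ^+ (j + 3).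
    by apply: ler_wiXn2l => //; rewrite ?invr_ge0// invf_le1// ler1n.
  rewrite exprD (_ : 2^-1 ^+ 3 = 8^-1); last by field.
  lra.
apply: (@le_trans _ _ (2^-1 ^+ (i + 4 * k))); last exact: ltW.
apply: expR_opp_le_half; rewrite natrD natrM.
have : k%:R <= j%:R + 2 :> R by rewrite -natrD ler_nat -ltnS -addnS.
lra.
Qed.

(** A lower bound on the distance to points of [S] is a closed condition, so it passes to the
    closure and then to the infimum. *)
Lemma lne_inv_dist_le (e : C) (S : set C) (G : R) :
  (forall w, S w -> expR (- G) <= normc (e - w)) ->
  (lne ((dist_to_set e (closure (S : set C^o)))^-1) <= G%:E)%E.
Proof.
move=> SG.
have clG w : closure (S : set C^o) w -> expR (- G) <= normc (e - w).
  move=> Sw; rewrite leNgt; apply/negP => ew.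
  have [|v [Sv /= vw]] := Sw [set v | normc (v - w) < expR (- G) - normc (e - w)].
    by apply/nbhs_normcP; exists (expR (- G) - normc (e - w)); rewrite ?subr_gt0.
  by have := SG v Sv; have := distcD w e v; rewrite (distcC w); lra.
have : ((expR (- G))%:E <= dist_to_set e (closure (S : set C^o)))%E.
  by apply: le_ereal_inf_tmp => _ [w Sw <-]; rewrite lee_fin clG.
case: dist_to_set => [r| |]//.
  rewrite lee_fin => Gr; have r0 : 0 < r by apply: lt_le_trans Gr; exact: expR_gt0.
  rewrite inver gt_eqF// lne_EFin ?invr_gt0// lee_fin lnV ?posrE//.
  by rewrite lerNl -ler_expR lnK// posrE.
(* Infinite distance occurs for an empty set: its inverse is 0, where [lne] takes the value -oo. *)
by move=> _; rewrite invey le0_lneNy// leNye.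
Qed.

(** Obtained directly from the integral as a supremum over simple functions, with the negative part
    of [f] only lowering the left side. It thus applies to the logarithm of the distance, whose
    measurability is never established. *)
Lemma le_integral_ge0 d (T : measurableType d) (mu : {measure set T -> \bar R})
    (D : set T) (f g : T -> \bar R) :
  (forall x, D x -> 0 <= g x)%E -> (forall x, D x -> f x <= g x)%E ->
  (\int[mu]_(x in D) f x <= \int[mu]_(x in D) g x)%E.
Proof.
move=> g0 fg; rewrite (ge0_integralE mu g0).
rewrite /integral; apply: (@le_trans _ _ (ereal_sup [set sintegral mu h |
   h in [set h : {nnsfun T >-> R} | forall x, ((h x)%:E <= ((f \_ D)^\+)%E x)%E]])).
  apply: geeDl; rewrite oppe_le0; apply: ereal_sup_ubound.
  by exists nnsfun0 => /=; [move=> x; exact: funeneg_ge0|exact: sintegral0].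
apply: ereal_sup_le => _ [h hf <-]; exists h => // x.
apply: le_trans (hf x) _; rewrite funeposE !patchE.
case: ifPn => [|_]; last by rewrite maxxx.
by rewrite inE => Dx; rewrite ge_max fg// g0.
Qed.

End LogDistance.

(** * The integrable majorant and the conclusion *)

Section FinalEstimates.
Context {R : realType}.
Local Notation C := R[i].
Local Notation mu := (@lebesgue_measure R).

(** [k] is the least exponent meeting the first bound. Minimality gives the second one, except at
    [k = 0], where [d < 2] does. *)
Lemma dyadic_scale (d : R) : 0 < d < 2 ->
  exists k : nat, 2^-1 ^+ k.+1 <= d /\ d <= 2 * 2^-1 ^+ k.
Proof.
move=> /andP[d0 d2].
have exk : exists k, (2^-1 : R) ^+ k.+1 <= d.
  exists (Num.truncn d^-1).+1; rewrite exprVn -[leRHS]invrK.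
  rewrite lef_pV2 ?posrE ?invr_gt0// ?exprn_gt0//.
  apply: ltW; apply: lt_le_trans (truncnS_gt _) _.
  by rewrite -natrX ler_nat ltnW// ltnW// ltn_expl.
have [k kd kmin] := ex_minnP exk; exists k; split=> //.
case: k => [|k] in kd kmin *; first by rewrite expr0; lra.
rewrite leNgt; apply/negP => dk.
suff : (k.+1 <= k)%N by rewrite ltnn.
by apply: kmin; apply: ltW; move: dk; rewrite exprS; lra.
Qed.

(** Triangle inequality through [z]: the radial displacement is 1 - |z|, itself at most |1 - z|. *)
Lemma normc_direction_sub1 (z : C) : normc z < 1 -> z != 0 ->
  normc (z / `|z| - 1) <= 2 * normc (1 - z).
Proof.
move=> z1 z0; have nz : 0 < normc z by rewrite normc_gt0.
have Nz : (normc z)%:C%C != 0 :> C by rewrite -normc_gt0 normc_real normr_gt0 gt_eqF.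
apply: le_trans (distcD z _ _) _; rewrite (distcC z 1).
have -> : z / `|z| - z = z / (normc z)%:C%C * (1 - normc z)%:C%C.
  by rewrite normcE rmorphB /= rmorph1; field.
rewrite !normcM normcV !normc_real !ger0_norm ?subr_ge0 ?(ltW nz) ?(ltW z1)//.
rewrite divff ?gt_eqF// mul1r.
have := distcD z 1 0; rewrite !subr0 normc1; lra.
Qed.

Lemma normc_direction (z : C) : z != 0 -> normc (z / `|z|) = 1.
Proof.
move=> z0; have nz : 0 < normc z by rewrite normc_gt0.
by rewrite normcM normcV normcE normc_real gtr0_norm// divff// gt_eqF.
Qed.

Lemma unit_circleE (z : C) : unit_circle z <-> normc z = 1.
Proof.
rewrite /unit_circle /= normcE; split=> [[]//|->]; exact: rmorph1.
Qed.

Lemma closed_unit_circle (S : set C) :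
  (forall z, S z -> normc z = 1) ->
  forall z, closure (S : set C^o) z -> normc z = 1.
Proof.
move=> S1 z Sz; apply/eqP; rewrite -subr_eq0 -normr_le0.
rewrite leNgt; apply/negP => pos.
have [|v [Sv /= vz]] := Sz [set v | normc (v - z) < `|normc z - 1|].
  by apply/nbhs_normcP; exists `|normc z - 1|.
have := dist_normc v z; rewrite (S1 v Sv) distrC; lra.
Qed.

Lemma compact_closure_circle (S : set C) : (forall z, S z -> normc z = 1) ->
  compact (closure (S : set C^o)).
Proof.
move=> S1; apply: (@subclosed_compact C^o _ _ _ (@closed_disc_compact R 1)).
  exact: closed_closure.
by move=> z /(closed_unit_circle S1) z1; rewrite /= z1.
Qed.

(** The exponent of [normc_ge_exp], with the sum over [n] in place of a supremum so that it is
    uniform in [n] and can be integrated termwise. *)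
Definition log_majorant (zeta : nat -> C) (k : nat -> nat) (t : R) : \bar R :=
  (8%:E + 4%:E * arc_count (1%R : C) 0 t +
   \sum_(n <oo) arc_count (zeta n) (4 * k n)%N t)%E.

(** Where the count at 1 and the series are finite, [normc_ge_exp] applies to all points with one
    exponent, since each count is at most the series; elsewhere the majorant is +oo. *)
Lemma lne_inv_dist_majorant (zeta : nat -> C) (k : nat -> nat) (P : set nat) t :
  0 <= t <= 2 * pi ->
  (forall n, P n -> normc (zeta n - 1) <= 4 * 2^-1 ^+ k n) ->
  (lne ((dist_to_set (circle_point t) (closure ((zeta @` P) : set C^o)))^-1) <=
     log_majorant zeta k t)%E.
Proof.
move=> t2 zk; rewrite /log_majorant.
have c0 n : (0 <= arc_count (zeta n) (4 * k n)%N t)%E by exact: arc_count_ge0.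
have term n : (arc_count (zeta n) (4 * k n)%N t <=
    \sum_(n <oo) arc_count (zeta n) (4 * k n)%N t)%E.
  apply: le_trans (nneseries_lim_ge n.+1 (fun i _ _ => c0 i)).
  by rewrite big_nat_recr//= leeDr// sume_ge0.
have S0 : (0 <= \sum_(n <oo) arc_count (zeta n) (4 * k n)%N t)%E.
  exact: le_trans (term 0%N).
have Y0 : (0 <= arc_count (1%R : C) 0 t)%E by exact: arc_count_ge0.
move: term S0; set S := (\sum_(n <oo) _)%E; case: S => [S| |]//.
- move: Y0; case EY : (arc_count _ _ t) => [Y| |]// Y0 term S0.
    apply: lne_inv_dist_le => _ [n Pn <-].
    by apply: (@normc_ge_exp _ _ (k n)) => //; [exact: zk|rewrite EY].
  by rewrite gt0_muley ?lte_fin// addey// addye// leey.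
- by move=> _ _; rewrite addey ?leey// -ltNye; apply: lt_le_trans (ltNyr 0) _;
    rewrite adde_ge0// mule_ge0.
Qed.

Lemma log_majorant_integral (zeta : nat -> C) (k : nat -> nat) (M : R) :
  (forall N, \sum_(n < N) (2^-1 : R) ^+ (4 * k n) <= M) ->
  (\int[mu]_(t in `[0%R, (2 * pi)%R]) log_majorant zeta k t < +oo)%E.
Proof.
move=> kM; pose I : set R := `[0, 2 * pi]%classic.
have mI : measurable I by exact: measurable_itv.
have mc z m : measurable_fun I (arc_count (z : C) m).
  by apply: measurable_funTS; exact: measurable_arc_count.
have ms : measurable_fun I (fun t => \sum_(n <oo) arc_count (zeta n) (4 * k n)%N t)%E.
  by apply: ge0_emeasurable_sum => // n t _ _; exact: arc_count_ge0.
have s0 t : (0 <= \sum_(n <oo) arc_count (zeta n) (4 * k n)%N t)%E.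
  by apply: nneseries_ge0 => n _ _; exact: arc_count_ge0.
have mY : measurable_fun I (fun t => 4%:E * arc_count (1%R : C) 0 t)%E.
  by apply: emeasurable_funM => //; exact: measurable_cst.
have y0 t : (0 <= 4%:E * arc_count (1%R : C) 0 t)%E.
  by rewrite mule_ge0// ?lee_fin// arc_count_ge0.
have m8 : measurable_fun I (fun=> 8%:E : \bar R) by exact: measurable_cst.
have e8 : (0 <= 8%:E :> \bar R)%E by rewrite lee_fin.
rewrite /log_majorant ge0_integralD//; last 2 first.
- by move=> t _; rewrite adde_ge0.
- exact: emeasurable_funD.
rewrite ge0_integralD//.
rewrite integral_nneseries//; last 2 first.
- by move=> n; exact: mc.
- by move=> n t _; exact: arc_count_ge0.
apply: lte_add_pinfty; first apply: lte_add_pinfty.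
- have -> : (\int[mu]_(t in I) 8%:E = \int[mu]_(t in I) cst 8%:E t)%E by [].
  rewrite integral_cst// lte_mul_pinfty//.
  have : (mu I < +oo)%E; last exact.
  by rewrite /I lebesgue_measure_itv/=; case: ifP => _; rewrite ?ltry// -EFinB ltry.
- rewrite ge0_integralZl//; last by move=> t _; exact: arc_count_ge0.
  rewrite lte_mul_pinfty//.
    exact: le_lt_trans (integral_arc_count _ _) (ltry _).
  exact: mc.
apply: (@le_lt_trans _ _ (arc_const * 2 * M)%:E); last exact: ltry.
apply: nneseries_le => [n|N]; first by apply: integral_ge0 => t _; exact: arc_count_ge0.
apply: (@le_trans _ _ (\sum_(n < N) (arc_const * 2 * 2^-1 ^+ (4 * k n))%:E)%E).
  by apply: lee_sum => n _; exact: integral_arc_count.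
rewrite sumEFin lee_fin -mulr_sumr ler_wpM2l// mulr_ge0//.
exact: ltW (arc_const_gt0 (R := R)).
Qed.

End FinalEstimates.

Theorem theorem7p1 (R : realType) (Omega : set (nat -> R[i]))
    (Omega_disc : forall z, Omega z -> forall n, @unit_disc R (z n))
    (Omega_zero : forall z, Omega z -> zero_sequence z)
    (Omega_closed : forall z w, Omega z ->
       (forall n, @unit_disc R (w n)) ->
       (forall n, `|1 - w n| <= `|1 - z n|) -> Omega w) :
  forall z, Omega z ->
    carleson_set
      (closure ([set z n / `|z n| | n in [set n | z n != 0]] : set (R[i])^o)).
Proof.
move=> z Oz.
have z1 n : normc (z n) < 1 by apply/unit_discE; exact: Omega_disc.
have /choice[k kP] : forall n, exists k : nat,
    2^-1 ^+ k.+1 <= normc (1 - z n) /\ normc (1 - z n) <= 2 * 2^-1 ^+ k.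
  move=> n; apply: dyadic_scale; apply/andP; split.
    rewrite normc_gt0 subr_eq0; apply/eqP => E.
    by have := z1 n; rewrite -E normc1 ltxx.
  by apply: le_lt_trans (normcB _ _) _; rewrite normc1; have := z1 n; lra.
pose w n : R[i] := (1 - 2^-1 ^+ (k n).+1)%:C%C.
have half n : 0 < (2^-1 : R) ^+ (k n).+1 <= 1.
  by rewrite exprn_gt0 ?invr_gt0//= exprn_ile1//; lra.
have Ow : Omega w.
  apply: (Omega_closed z w Oz) => n.
    by apply/unit_discE; rewrite normc_real ger0_norm; have /andP[] := half n; lra.
  have -> : 1 - w n = (2^-1 ^+ (k n).+1)%:C%C.
    by rewrite /w rmorphB rmorph1 opprB addrC subrK.
  have /andP[e0 _] := half n.
  by rewrite !normcE lecR normc_real gtr0_norm//; have [] := kP n.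
have [M M0 kM] := dyadic_zeros_bound (fun=> erefl) (Omega_zero w Ow).
have kS := dyadic_sum_bound M0 kM.
have S1 v : [set z n / `|z n| | n in [set n | z n != 0]] v -> normc v = 1.
  by move=> [n /= zn0 <-]; exact: normc_direction.
split.
- exact: compact_closure_circle.
- by move=> v /(closed_unit_circle S1) v1; apply/unit_circleE.
(* An index with [z n = 0] gets the default centre 0 / 0 = 0; its term in the majorant is
   nonnegative and obeys the same integral bound. *)
apply: le_lt_trans (log_majorant_integral (fun n => z n / `|z n|) kS).
apply: le_integral_ge0 => t.
  move=> _; rewrite /log_majorant !adde_ge0// ?mule_ge0// ?arc_count_ge0//.
  by apply: nneseries_ge0 => n _ _; exact: arc_count_ge0.
rewrite /= in_itv/= => t2; apply: lne_inv_dist_majorant => // n /= zn0.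
apply: le_trans (normc_direction_sub1 (z1 n) zn0) _.
by have [_] := kP n; lra.
Qed.
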